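(* Let $\mathfrak L$ be a Lie conformal algebra over a field $\Bbbk$ of characteristic $0$, generated by a set $\mathcal G\subset\mathfrak L$. Assume that there is $K\in\mathbb Z$ such that $S_{\mathfrak L,\mathcal G}(l)\le K$ for all $l$, i.e. for every $l\ge 1$, every word $g_1[n_1]\cdots[n_{l-1}]g_l\in\mathfrak L$ (with arbitrary order of parentheses), where $g_i\in\mathcal G$ and $n_i\in\mathbb Z_+$, is zero whenever $\sum_i n_i\ge K$. Then $\mathfrak L$ is embeddable into an associative conformal algebra $\mathfrak A$ (that is, $\mathfrak L$ is isomorphic to a conformal subalgebra of $\mathfrak A^{(-)}$) such that $S_{\mathfrak A,\mathcal G}(l)\le K$ for all $l$, i.e. every word $g_1(n_1)\cdots(n_{l-1})g_l\in\mathfrak A$ (with arbitrary order of parentheses), where $g_i\in\mathcal G$ and $n_i\in\mathbb Z_+$, is zero in $\mathfrak A$ whenever $\sum_i n_i\ge K$.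
   Context: All spaces are over a field $\Bbbk$ of characteristic $0$; $\mathbb Z_+=\{0,1,2,\dots\}$; $x^{(n)}=\frac1{n!}x^n$ (divided powers). A conformal algebra is a vector space $\mathfrak A$ with bilinear products $a\otimes b\mapsto a(n)b$, $n\in\mathbb Z_+$, and a linear map $D:\mathfrak A\to\mathfrak A$ such that (C1) for all $a,b$, $a(n)b=0$ for $n\gg0$; (C2) $D(a(n)b)=(Da)(n)b+a(n)(Db)$ and $(Da)(n)b=-n\,a(n-1)b$. It is generated by $\mathcal G$ if it is the smallest $D$-invariant subspace containing $\mathcal G$ and closed under all products. It is an associative conformal algebra if $(a(m)b)(n)c=\sum_{s\ge0}(-1)^s\binom ms a(m-s)\big(b(n+s)c\big)$ for all $a,b,c$ and $m,n\in\mathbb Z_+$. It is a Lie conformal algebra (products then written $a[n]b$) if for all $a,b,c$ and $m,n\in\mathbb Z_+$: $a[n]b=-\sum_{s\ge0}(-1)^{n+s}D^{(s)}(b[n+s]a)$ and $(a[m]b)[n]c=\sum_{s\ge0}(-1)^s\binom ms\big(a[m-s](b[n+s]c)-b[n+s](a[m-s]c)\big)$. For an associative conformal algebra $\mathfrak A$, $\mathfrak A^{(-)}$ is the Lie conformal algebra on the same space with the same $D$ and products $a[n]b=a(n)b-\sum_{s\ge0}(-1)^{n+s}D^{(s)}\big(b(n+s)a\big)$. In the conclusion, $\mathcal G$ is identified with its image under $\mathfrak L\hookrightarrow\mathfrak A^{(-)}$. *)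

(* Defs.v *)
From HB Require Import structures.
From mathcomp Require Import all_boot all_order all_algebra.
From mathcomp Require Import all_classical.

Set Implicit Arguments.
Unset Strict Implicit.
Unset Printing Implicit Defensive.

Import GRing.Theory.
Local Open Scope classical_set_scope.
Local Open Scope ring_scope.

Reserved Notation "x *[ n ] y" (at level 40, n at level 99, left associativity,
  format "x  *[ n ]  y").

HB.mixin Record isConformalAlgebra (F : fieldType) V of GRing.Lmodule F V := {
  cderiv : V -> V;
  cprod : nat -> V -> V -> V;
  cderiv_is_linear : linear cderiv;
  cprod_linearl : forall n (b : V), linear (fun a => cprod n a b);
  cprod_linearr : forall n (a : V), linear (cprod n a);
  cprod_local : forall a b : V,
    exists N, forall n, (N <= n)%N -> cprod n a b = 0;
  cderiv_cprod : forall n (a b : V),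
    cderiv (cprod n a b) = cprod n (cderiv a) b + cprod n a (cderiv b);
  (* For [n = 0] the right-hand side is [0], whatever [n.-1] is. *)
  cprod_cderivl : forall n (a b : V),
    cprod n (cderiv a) b = - (cprod n.-1 a b *+ n)
}.

#[short(type="conformalAlgType")]
HB.structure Definition ConformalAlgebra (F : fieldType) :=
  {V of isConformalAlgebra F V & GRing.Lmodule F V}.

HB.instance Definition _ (F : fieldType) (A : conformalAlgType F) :=
  GRing.isLinear.Build F A A *:%R (@cderiv F A) (@cderiv_is_linear F A).

Notation "x *[ n ] y" := (cprod n x y) : ring_scope.

(* [D ^ s / s!]. *)
Definition cderiv_div (F : fieldType) (A : conformalAlgType F) (s : nat)
    (x : A) : A :=
  (s`!%:R : F)^-1 *: iter s cderiv x.

(* [{b (n) a} = sum_(s >= 0) (-1)^(n + s) D^(s) (b (n + s) a)]; the support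
   of the summand is finite by [cprod_local]. *)
Definition cprod_opp (F : fieldType) (A : conformalAlgType F) (n : nat)
    (a b : A) : A :=
  \sum_(s \in [set: nat])
    ((-1) ^+ (n + s) : F) *: cderiv_div s (b *[n + s] a).

(* Since ['C(m, s) = 0] for [m < s], the sums below stop at [s = m]. *)
HB.mixin Record isAssocConformal (F : fieldType) V
    of ConformalAlgebra F V := {
  cprodA : forall m n (a b c : V),
    (a *[m] b) *[n] c =
    \sum_(s < m.+1)
      ((-1) ^+ s * 'C(m, s)%:R : F) *: (a *[m - s] (b *[n + s] c))
}.

#[short(type="assocConformalAlgType")]
HB.structure Definition AssocConformalAlgebra (F : fieldType) :=
  {V of isAssocConformal F V & ConformalAlgebra F V}.

HB.mixin Record isLieConformal (F : fieldType) V of ConformalAlgebra F V := {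
  cbracketC : forall n (a b : V), a *[n] b = - cprod_opp n a b;
  cbracketJ : forall m n (a b c : V),
    (a *[m] b) *[n] c =
    \sum_(s < m.+1)
      ((-1) ^+ s * 'C(m, s)%:R : F) *:
        (a *[m - s] (b *[n + s] c) - b *[n + s] (a *[m - s] c))
}.

#[short(type="lieConformalAlgType")]
HB.structure Definition LieConformalAlgebra (F : fieldType) :=
  {V of isLieConformal F V & ConformalAlgebra F V}.

Definition conformal_subalgebra (F : fieldType) (A : conformalAlgType F) :
    set (set A) :=
  [set U | [/\ U 0,
               forall (k : F) x y, U x -> U y -> U (k *: x + y),
               forall x, U x -> U (cderiv x) &
               forall n x y, U x -> U y -> U (x *[n] y)]].

Definition conformal_generates (F : fieldType) (A : conformalAlgType F)
    (G : set A) : Prop :=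
  smallest (@conformal_subalgebra F A) G = [set: A].

(* [conformal_word G l m x]: [x] is the value of a word of length [l] in
   elements of [G], under some bracketing, whose indices sum up to [m]. *)
Inductive conformal_word (F : fieldType) (A : conformalAlgType F) (G : set A) :
    nat -> nat -> A -> Prop :=
| conformal_word_gen g : G g -> conformal_word G 1 0 g
| conformal_word_mul l1 l2 m1 m2 n x y :
    conformal_word G l1 m1 x -> conformal_word G l2 m2 y ->
    conformal_word G (l1 + l2) (m1 + m2 + n) (x *[n] y).

(* The locality function satisfies [S_(A, G) l <= K]. *)
Definition locality_le (F : fieldType) (A : conformalAlgType F) (G : set A)
    (l : nat) (K : int) : Prop :=
  forall (m : nat) (x : A), conformal_word G l m x -> (K <= m%:Z)%R -> x = 0.

Definition conformal_morphism (F : fieldType) (A B : conformalAlgType F)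
    (f : A -> B) : Prop :=
  [/\ linear f,
      forall x, f (cderiv x) = cderiv (f x) &
      forall n x y, f (x *[n] y) = f x *[n] f y].

Lemma fsum_nat_bounded (V : nmodType) (f : nat -> V) (N : nat) :
  (forall s, (N <= s)%N -> f s = 0) ->
  \sum_(s \in [set: nat]) f s = \sum_(0 <= s < N) f s.
Proof.
move=> fN; rewrite -(fsbig_widen `I_N) //=; last first.
  by move=> s [_ /= /negP]; rewrite -leqNgt => /fN.
by rewrite big_mkord -fsbig_ord.
Qed.

Section Minus.
Variables (F : fieldType) (A : conformalAlgType F).
Implicit Types a b c d x y : A.

Lemma cderiv_div_is_linear s : linear (@cderiv_div F A s).
Proof.
move=> k x y; rewrite /cderiv_div scalerA mulrC -scalerA -scalerDr; congr (_ *: _).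
by elim: s => //= s ->; rewrite linearP.
Qed.

HB.instance Definition _ s :=
  GRing.isLinear.Build F A A *:%R (@cderiv_div F A s)
    (@cderiv_div_is_linear s).

Lemma cderiv_divC s x : cderiv (cderiv_div s x) = cderiv_div s (cderiv x).
Proof. by rewrite /cderiv_div linearZ /= -iterS iterSr. Qed.

Lemma cprod_oppE n a b N : (forall k, (N <= k)%N -> b *[k] a = 0) ->
  cprod_opp n a b = \sum_(0 <= s < N)
    ((-1) ^+ (n + s) : F) *: cderiv_div s (b *[n + s] a).
Proof.
move=> h; apply: fsum_nat_bounded => s hs.
by rewrite h ?linear0 ?scaler0 // (leq_trans hs) ?leq_addl.
Qed.

Lemma cprod_local2 a b c d : exists N, forall k, (N <= k)%N ->
  a *[k] b = 0 /\ c *[k] d = 0.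
Proof.
have [N1 h1] := cprod_local a b; have [N2 h2] := cprod_local c d.
exists (maxn N1 N2) => k; rewrite geq_max => /andP[? ?].
by rewrite h1 ?h2.
Qed.

Lemma cprod_opp_linearl n b : linear (fun a => @cprod_opp F A n a b).
Proof.
move=> k x y; have [N hN] := cprod_local2 b x b y.
have h1 j : (N <= j)%N -> b *[j] x = 0 by case/hN.
have h2 j : (N <= j)%N -> b *[j] y = 0 by case/hN.
have h3 j : (N <= j)%N -> b *[j] (k *: x + y) = 0.
  by move=> hj; rewrite cprod_linearr h1 ?h2 // scaler0 addr0.
rewrite (cprod_oppE n h1) (cprod_oppE n h2) (cprod_oppE n h3).
rewrite scaler_sumr -big_split; apply: eq_bigr => s _ /=.
by rewrite cprod_linearr linearP scalerDr (scalerA _ k) mulrC -scalerA.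
Qed.

Lemma cprod_opp_linearr n a : linear (@cprod_opp F A n a).
Proof.
move=> k x y; have [N hN] := cprod_local2 x a y a.
have h1 j : (N <= j)%N -> x *[j] a = 0 by case/hN.
have h2 j : (N <= j)%N -> y *[j] a = 0 by case/hN.
have h3 j : (N <= j)%N -> (k *: x + y) *[j] a = 0.
  by move=> hj; rewrite cprod_linearl h1 ?h2 // scaler0 addr0.
rewrite (cprod_oppE n h1) (cprod_oppE n h2) (cprod_oppE n h3).
rewrite scaler_sumr -big_split; apply: eq_bigr => s _ /=.
by rewrite cprod_linearl linearP scalerDr (scalerA _ k) mulrC -scalerA.
Qed.

Lemma cderiv_cprod_opp n a b :
  cderiv (cprod_opp n a b) = cprod_opp n (cderiv a) b + cprod_opp n a (cderiv b).
Proof.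
have [N1 h1] := cprod_local b a.
have [N2 h2] := cprod_local2 b (cderiv a) (cderiv b) a.
pose N := maxn N1 N2.
have h3 j : (N <= j)%N -> b *[j] a = 0 by rewrite geq_max => /andP[/h1].
have h4 j : (N <= j)%N -> b *[j] cderiv a = 0.
  by rewrite geq_max => /andP[_ /h2[]].
have h5 j : (N <= j)%N -> cderiv b *[j] a = 0.
  by rewrite geq_max => /andP[_ /h2[]].
rewrite (cprod_oppE n h3) (cprod_oppE n h4) (cprod_oppE n h5).
rewrite linear_sum -big_split; apply: eq_bigr => s _ /=.
by rewrite linearZ /= cderiv_divC cderiv_cprod linearD scalerDr addrC.
Qed.

Hypothesis pcharF : [pchar F] =i pred0.

Lemma cderiv_divS s x : cderiv_div s (cderiv x) = cderiv_div s.+1 x *+ s.+1.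
Proof.
have s1_neq0 : (s.+1%:R : F) != 0 by rewrite (pcharf0P F).1.
rewrite /cderiv_div -iterSr -scaler_nat scalerA factS natrM invfM mulrA.
by rewrite divff ?mul1r.
Qed.

Lemma cprod_opp_cderivl n a b :
  cprod_opp n (cderiv a) b = - (cprod_opp n.-1 a b *+ n).
Proof.
have [N hN] := cprod_local2 b a b (cderiv a).
have h1 j : (N < j)%N -> b *[j] a = 0 by move/ltnW/hN => [].
have h2 j : (N < j)%N -> b *[j] cderiv a = 0 by move/ltnW/hN => [].
rewrite (cprod_oppE n h2) (cprod_oppE n.-1 h1).
pose G s := ((-1) ^+ (n + s) : F) *: (cderiv_div s (b *[(n + s).-1] a)).
have E s : ((-1) ^+ (n + s) : F) *: cderiv_div s (b *[n + s] cderiv a) =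
    G s *+ (n + s) - G s.+1 *+ s.+1.
  have -> : b *[n + s] cderiv a =
      cderiv (b *[n + s] a) + b *[(n + s).-1] a *+ (n + s).
    by rewrite cderiv_cprod cprod_cderivl addrAC addNr add0r.
  rewrite linearD /= cderiv_divS scalerDr addrC; congr (_ + _).
    by rewrite (raddfMn (@cderiv_div F A s)) -scalerMnr.
  by rewrite /G addnS /= exprS mulN1r scaleNr mulNrn opprK -scalerMnr.
rewrite (eq_bigr _ (fun s _ => E s)).
have -> : \sum_(0 <= s < N.+1) (G s *+ (n + s) - G s.+1 *+ s.+1) =
    \sum_(0 <= s < N.+1) G s *+ n.
  under eq_bigr => s _ do rewrite mulrnDr -addrA.
  rewrite big_split /= -[RHS]addr0; congr (_ + _).
  under eq_bigr => s _ do rewrite -opprB.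
  rewrite sumrN telescope_sumr // mulr0n subr0 /G.
  rewrite addnS (hN (n + N)%N (leq_addl _ _)).1.
  by rewrite (linear0 (@cderiv_div F A N.+1)) scaler0 mul0rn oppr0.
rewrite -sumrMnl -sumrN; apply: eq_bigr => s _; rewrite /G.
case: n {E G} => [|n]; first by rewrite !mulr0n oppr0.
by rewrite addSn exprS mulN1r scaleNr mulNrn.
Qed.

End Minus.

(* Carrier of [A^(-)]. Characteristic [0] is needed for the axiom
   [(D a)[n] b = - n a[n-1] b], because of the divided powers. *)
Definition cminus (F : fieldType) (_ : [pchar F] =i pred0) (A : Type) : Type :=
  A.

Section MinusInstance.
Variables (F : fieldType) (pcharF : [pchar F] =i pred0).
Variable A : assocConformalAlgType F.

Definition cminus_prod (n : nat) (a b : A) : A := a *[n] b - cprod_opp n a b.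

HB.instance Definition _ := GRing.Lmodule.on (cminus pcharF A).

Lemma cminus_prod_linearl n (b : A) : linear (fun a => cminus_prod n a b).
Proof.
move=> k x y; rewrite /cminus_prod cprod_linearl cprod_opp_linearl.
by rewrite scalerBr opprD addrACA.
Qed.

Lemma cminus_prod_linearr n (a : A) : linear (cminus_prod n a).
Proof.
move=> k x y; rewrite /cminus_prod cprod_linearr cprod_opp_linearr.
by rewrite scalerBr opprD addrACA.
Qed.

Lemma cminus_prod_local (a b : A) :
  exists N, forall n, (N <= n)%N -> cminus_prod n a b = 0.
Proof.
have [N hN] := cprod_local2 a b b a; exists N => n hn.
have h j : (N <= j)%N -> b *[j] a = 0 by case/hN.
rewrite /cminus_prod (hN _ hn).1 (cprod_oppE n h).
rewrite big1 ?subr0 // => s _.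
by rewrite (hN _ _).2 ?linear0 ?scaler0 // (leq_trans hn) ?leq_addr.
Qed.

Lemma cderiv_cminus_prod n (a b : A) :
  cderiv (cminus_prod n a b) =
  cminus_prod n (cderiv a) b + cminus_prod n a (cderiv b).
Proof.
by rewrite /cminus_prod linearB /= cderiv_cprod cderiv_cprod_opp opprD addrACA.
Qed.

Lemma cminus_prod_cderivl n (a b : A) :
  cminus_prod n (cderiv a) b = - (cminus_prod n.-1 a b *+ n).
Proof.
rewrite /cminus_prod cprod_cderivl (cprod_opp_cderivl pcharF) mulrnBl.
by rewrite opprB opprK addrC.
Qed.

HB.instance Definition _ :=
  isConformalAlgebra.Build F (cminus pcharF A)
    (@cderiv_is_linear F A) cminus_prod_linearl cminus_prod_linearr
    cminus_prod_local cderiv_cminus_prod cminus_prod_cderivl.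

End MinusInstance.

(* Main.v *)
Require Import Defs.
From HB Require Import structures.
From mathcomp Require Import all_boot all_order all_algebra.
From mathcomp Require Import all_classical.
From mathcomp Require Import zify ring.

(** Let g be the coefficient Lie algebra of L, spanned by the modes a(n) with
    a in L and n an integer, where D a (n) = - n a(n-1) and
      [a(m), b(n)] = sum_t C(m, t) (a[t]b)(m + n - t).
    Assign to a word of L the sum of its indices as weight, and let I be the
    span in U(g) of all coefficients of the products
      P(z_1, ..., z_l) u_1(z_1) ... u_l(z_l)
    where the u_i are words in the generators, P is a product of differences
    z_a - z_b, and deg P plus the weights of the u_i is at least K.  It is an
    ideal.  Over U(g)/I the formal distributions attached to the generators
    generate an associative conformal algebra in which the words of weight at
    least K vanish, and since the commutator of two such distributions is the
    bracket of g, it receives a morphism from L into its Lie conformal algebra.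

    What has to be seen is that I does not meet g, so that this morphism is
    injective.  Interchanging two neighbours u_i(z_i), u_j(z_j) costs
      sum_t (u_i[t]u_j)(z_j) delta^(t)(z_i - z_j) / t!,
    and multiplying by P turns delta^(t) into combinations of delta^(t-s)
    whose coefficients have degree deg P - s, with s <= t.  The bracket has
    gained t in weight and P has lost at most t in degree, so the bound K is
    preserved.  Symmetrizing the products therefore never leaves I: the ideal
    is homogeneous for the decomposition U(g) = sum_l S^l(g), and its
    component in S^1(g) = g is spanned by modes of words of L of weight at least
    K, which are 0 by hypothesis.

    No enveloping algebra and no quotient is formed below; everything is
    tested on functionals.  A functional on the tensor algebra of g is a
    function of lists of pairs (a, n), the letters.  The decisive one is
    [lie_proj], the projection of U(g) onto g along the other symmetric powers
    followed by the map from g to L that applies a mode to the vacuum, that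
    is, a(-1-k) |-> D^(k) a and a(n) |-> 0 for n >= 0.  The projection is
    built by recursion on the length of words, averaging over all
    rearrangements of a word; that it respects the commutation relations
    ([pbw_proj_swap]) is the part of the Poincare-Birkhoff-Witt theorem in
    characteristic 0 that is needed.  [diff_null_contraction] is the count of
    degrees explained above, and [lie_proj_null] its consequence that
    [lie_proj] vanishes on I.  The modes then act on the space of all
    functionals with these properties by appending letters.  In the algebra of
    endomorphisms of that space the relations of U(g)/I hold by construction,
    and a is recovered from a(-1) by evaluating on [lie_proj]. *)

Set Implicit Arguments.
Unset Strict Implicit.
Unset Printing Implicit Defensive.

Import GRing.Theory.
Local Open Scope classical_set_scope.
Local Open Scope ring_scope.

(** * Preliminaries *)
Lemma natF_neq0 (F : fieldType) (pcharF : [pchar F] =i pred0) n :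
  (n.+1%:R : F) != 0.
Proof. by rewrite (pcharf0P F).1. Qed.

Lemma linear_at0 (F : fieldType) (U V : lmodType F) (f : U -> V) :
  linear f -> f 0 = 0.
Proof.
move=> /(_ 1 0 0); rewrite !scale1r addr0.
by move/esym/(canRL (addrK _)); rewrite subrr.
Qed.

Lemma exists_fresh (r : seq nat) : exists N, forall i, i \in r -> (i < N)%N.
Proof.
exists (\max_(i <- r) i).+1 => i hi.
by rewrite ltnS; apply: (@leq_bigmax_seq _ _ xpredT id).
Qed.

(** * Sums over the factorizations of a word *)
Section Splits.
Variables (X : Type) (W : zmodType).
Implicit Types (F G : seq X -> X -> seq X -> W) (w p q : seq X).

Fixpoint sum_splits F w : W :=
  if w is x :: w' then F [::] x w' + sum_splits (fun a m b => F (x :: a) m b) w'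
  else 0.

Lemma sum_splits_cat F p q : sum_splits F (p ++ q) =
  sum_splits (fun a m b => F a m (b ++ q)) p
  + sum_splits (fun a m b => F (p ++ a) m b) q.
Proof. by elim: p F => [|x p IH] F /=; rewrite ?add0r // IH addrA. Qed.

Lemma eq_sum_splits F G w :
  (forall a m b, w = a ++ m :: b -> F a m b = G a m b) ->
  sum_splits F w = sum_splits G w.
Proof.
elim: w F G => //= x w IH F G h; rewrite h //; congr (_ + _).
by apply: IH => a m b e; apply: h; rewrite e.
Qed.

Lemma sum_splitsB F G w :
  sum_splits (fun a m b => F a m b - G a m b) w = sum_splits F w - sum_splits G w.
Proof.
by elim: w F G => [|x w IH] F G /=; rewrite ?subr0 // IH opprD addrACA.
Qed.

Lemma sum_splits_const c w : sum_splits (fun _ _ _ => c) w = c *+ size w.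
Proof. by elim: w => //= x w ->; rewrite mulrS. Qed.

End Splits.

(** * The projection of an enveloping algebra onto its Lie algebra *)
Section PBW.
Variables (F : fieldType) (X : Type) (W : lmodType F).
Variable br : X -> X -> seq (F * X).

(** The letters in [X] stand for spanning elements of a Lie algebra, in which
    [br x y] is the bracket of [x] and [y] written as a formal linear
    combination of letters.  [brlin f x y] is then the value on the bracket of
    the linear functional that is [f] on letters.  That the formal bracket is
    skew-symmetric and satisfies the Jacobi identity is only meaningful for
    those [f] that come from a functional on the Lie algebra; they form the
    class [Adm]. *)
Definition brlin (f : X -> W) (x y : X) : W := \sum_(p <- br x y) p.1 *: f p.2.

Variable Adm : (X -> W) -> Prop.
Variable eps : X -> W.

Lemma eq_brlin f g x y : (forall z, f z = g z) -> brlin f x y = brlin g x y.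
Proof. by move=> fg; apply: eq_bigr => p _; rewrite fg. Qed.

Lemma brlinD f g x y : brlin (fun z => f z + g z) x y = brlin f x y + brlin g x y.
Proof. by rewrite /brlin -big_split; apply: eq_bigr => p _; rewrite scalerDr. Qed.

Lemma brlinB f g x y : brlin (fun z => f z - g z) x y = brlin f x y - brlin g x y.
Proof. by rewrite /brlin -sumrB; apply: eq_bigr => p _; rewrite scalerBr. Qed.

Lemma brlin0 x y : brlin (fun=> 0) x y = 0.
Proof. by rewrite /brlin big1 // => p _; rewrite scaler0. Qed.

Lemma exchange_brlin (f : X -> X -> W) x y x' y' :
  brlin (fun z => brlin (f z) x y) x' y' = brlin (fun z' => brlin (f^~ z') x' y') x y.
Proof.
rewrite /brlin; under eq_bigr do rewrite scaler_sumr.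
rewrite exchange_big; apply: eq_bigr => p _; rewrite scaler_sumr.
by apply: eq_bigr => q _; rewrite !scalerA mulrC.
Qed.

Lemma brlin_sum_splits (f : X -> seq X -> X -> seq X -> W) x y w :
  brlin (fun z => sum_splits (f z) w) x y =
  sum_splits (fun a m b => brlin (fun z => f z a m b) x y) w.
Proof. by elim: w f => [|m w IH] f /=; rewrite ?brlin0 // brlinD IH. Qed.

(** The sum of the brackets left over when the letter [m] is carried from the
    right end of [a] to its left end in the word [u ++ a ++ m :: b]; see
    [crossingE]. *)
Definition crossing (f : seq X -> W) u a m b : W :=
  sum_splits (fun a1 y a2 => brlin (fun z => f (u ++ a1 ++ z :: a2 ++ b)) y m) a.

(** The last [k] letters [w] of the word [u ++ w] are rearranged by choosing,
    uniformly at random among the remaining letters, the next letter to be put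
    behind [u].  [sort_avg] is the expected sum of the brackets collected on
    the way, that is, of the original word minus the rearranged one. *)
Fixpoint sort_avg (f : seq X -> W) k u w : W :=
  if k is k'.+1 then
    (k%:R : F)^-1 *:
      sum_splits (fun a m b => crossing f u a m b + sort_avg f k' (rcons u m) (a ++
        b)) w
  else 0.

(** The canonical projection on words of length [n], followed by [eps].  For
    [n > 1] it is determined by two requirements: the average of its values
    over all rearrangements of a word is 0, because symmetric tensors lie in
    the complement, and interchanging neighbours changes it by the value at
    level [n.-1] on the word that contains their bracket.  Together they say
    that a word has the value [sort_avg].  At other lengths than [n] the
    function means nothing. *)
Fixpoint pbw_level n : seq X -> W :=
  if n is n'.+1 then
    fun w => if w is [:: x] then eps x else sort_avg (pbw_level n') n [::] w
  else fun=> 0.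

Definition pbw_proj w := pbw_level (size w) w.

Hypothesis Adm0 : Adm (fun=> 0).
Hypothesis AdmP : forall k f g, Adm f -> Adm g -> Adm (fun z => k *: f z + g z).
Hypothesis Adm_brlinl : forall f y, Adm f -> Adm (fun x => brlin f x y).
Hypothesis Adm_brlinr : forall f x, Adm f -> Adm (fun y => brlin f x y).
Hypothesis brlinC : forall f x y, Adm f -> brlin f x y = - brlin f y x.
Hypothesis brlinJ : forall f x y m, Adm f ->
  brlin (fun z => brlin f z y) x m + brlin (fun z => brlin f x z) y m =
  brlin (fun z => brlin f z m) x y.
Hypothesis natF_neq0 : forall n, (n.+1%:R : F) != 0.
Hypothesis Adm_eps : Adm eps.

Lemma AdmD f g : Adm f -> Adm g -> Adm (fun z => f z + g z).
Proof.
by move=> hf /(AdmP 1 hf); congr Adm; apply/funext => z; rewrite scale1r.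
Qed.

Lemma AdmZ k f : Adm f -> Adm (fun z => k *: f z).
Proof.
by move=> /(AdmP k)/(_ Adm0); congr Adm; apply/funext => z; rewrite addr0.
Qed.

Lemma Adm_brlin f x y : (forall z, Adm (f z)) -> Adm (fun t => brlin (f^~ t) x y).
Proof.
move=> hf; rewrite /brlin; elim: (br x y) => [|p s IH].
  by move: Adm0; congr Adm; apply/funext => t; rewrite big_nil.
move: (AdmD (AdmZ p.1 (hf p.2)) IH).
by congr Adm; apply/funext => t; rewrite big_cons.
Qed.

Lemma Adm_sum_splits (f : X -> seq X -> X -> seq X -> W) w :
  (forall a m b, w = a ++ m :: b -> Adm (fun t => f t a m b)) ->
  Adm (fun t => sum_splits (f t) w).
Proof.
elim: w f => [|x w IH] f h //=.
apply: AdmD; first exact: h.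
by apply: (IH (fun t a m b => f t (x :: a) m b)) => a m b e; apply: h; rewrite e.
Qed.

Definition slotwise (f : seq X -> W) := forall u v, Adm (fun x => f (u ++ x :: v)).

(** A variable letter occurs in [crossing] in four places: as the moved
    letter, in the fixed prefix, among the crossed letters, and in the fixed
    suffix.  The first place is treated here and the others in the next
    lemma. *)
Lemma Adm_crossing_moved f p a b : slotwise f -> Adm (fun x => crossing f p a x b).
Proof.
move=> hf; apply: Adm_sum_splits => a1 y a2 _; apply: Adm_brlinr.
move: (hf (p ++ a1) (a2 ++ b)); congr Adm.
by apply/funext=> x; rewrite -catA.
Qed.

Lemma Adm_crossing f p q a m b : slotwise f ->
  [/\ Adm (fun x => crossing f (p ++ x :: q) a m b),
      Adm (fun x => crossing f a (p ++ x :: q) m b) &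
      Adm (fun x => crossing f a b m (p ++ x :: q))].
Proof.
move=> hf; split.
- apply: Adm_sum_splits => a1 y a2 _; apply: Adm_brlin => z.
  by move: (hf p (q ++ a1 ++ z :: a2 ++ b)); congr Adm; apply/funext=> x;
    rewrite -?catA /= -?catA.
- rewrite /crossing; under eq_fun do rewrite sum_splits_cat /=.
  apply: AdmD; [|apply: AdmD].
  + apply: Adm_sum_splits => a1 y a2 _; apply: Adm_brlin => z.
    by move: (hf (a ++ a1 ++ z :: a2) (q ++ b)); congr Adm;
      apply/funext=> x; rewrite -?catA /= -?catA.
  + apply: Adm_brlinl; move: (hf (a ++ p) (q ++ b)); congr Adm.
    by apply/funext=> x; rewrite -?catA ?cats0.
  + apply: Adm_sum_splits => a1 y a2 _; apply: Adm_brlin => z.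
    by move: (hf (a ++ p) (a1 ++ z :: a2 ++ b)); congr Adm;
      apply/funext=> x; rewrite -?catA /= -?catA.
- apply: Adm_sum_splits => a1 y a2 _; apply: Adm_brlin => z.
  by move: (hf (a ++ a1 ++ z :: a2 ++ p) q); congr Adm; apply/funext=> x;
    rewrite -?catA /= -?catA.
Qed.

Lemma Adm_sort_avg f k : slotwise f -> forall p q w,
  Adm (fun x => sort_avg f k (p ++ x :: q) w) /\
  Adm (fun x => sort_avg f k w (p ++ x :: q)).
Proof.
move=> hf; elim: k => [|k IH] p q w //=; split; apply: AdmZ.
  apply: Adm_sum_splits => a m b _; apply: AdmD.
    by have [] := Adm_crossing p q a m b hf.
  by have [+ _] := IH p (rcons q m) (a ++ b); congr Adm; apply/funext=> x;
    rewrite rcons_cat.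
under eq_fun do rewrite sum_splits_cat /=.
apply: AdmD; [|apply: AdmD].
- apply: Adm_sum_splits => a m b _; apply: AdmD.
    by have [_ _] := Adm_crossing b q w m a hf.
  have [_ +] := IH (a ++ b) q (rcons w m).
  by congr Adm; apply/funext=> x; rewrite -?catA.
- apply: AdmD; first exact: Adm_crossing_moved.
  have [+ _] := IH w [::] ((p ++ [::]) ++ q).
  by congr Adm; apply/funext=> x; rewrite cats1.
- apply: Adm_sum_splits => a m b _; apply: AdmD.
    by have [_ + _] := Adm_crossing p a w m b hf.
  have [_ +] := IH p (a ++ b) (rcons w m).
  by congr Adm; apply/funext=> x; rewrite -?catA.
Qed.

Lemma slotwise_pbw_level n : slotwise (pbw_level n).
Proof.
elim: n => [|n IH] u v //.
case: u => [|x0 u] /=.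
  case: v => [|x1 v] //; exact: (Adm_sort_avg n.+1 IH [::] (x1 :: v) [::]).2.
suff /(_ (Adm_sort_avg n.+1 IH (x0 :: u) v [::]).2) :
  Adm (fun x => sort_avg (pbw_level n) n.+1 [::] ((x0 :: u) ++ x :: v)) ->
  Adm (fun x => pbw_level n.+1 ((x0 :: u) ++ x :: v)) by [].
by congr Adm; apply/funext => x; case: u.
Qed.

Lemma slotwise_pbw_proj : slotwise pbw_proj.
Proof.
move=> u v; move: (slotwise_pbw_level (size u + size v).+1 u v); congr Adm.
by apply/funext=> x; rewrite /pbw_proj size_cat addnS.
Qed.

(** In this section [f] and [e] are the projection at two consecutive levels,
    and the commutation relation between them is assumed. *)
Section Step.
Variables (n : nat) (f e : seq X -> W).
Hypotheses (fA : slotwise f) (eA : slotwise e).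
Hypothesis fR : forall u x y v, (size u + size v).+2 = n ->
  f (u ++ x :: y :: v) - f (u ++ y :: x :: v) =
  brlin (fun z => e (u ++ z :: v)) x y.

Lemma crossingE u a m b : (size u + size a + size b).+1 = n ->
  f (u ++ a ++ m :: b) = f (u ++ m :: a ++ b) + crossing e u a m b.
Proof.
elim: a u => [|x a IH] u /= hn; first by rewrite addr0.
have := IH (rcons u x); rewrite /crossing /= size_rcons -cats1 -!catA /= => ->;
  last lia.
have /eqP := @fR u x m (a ++ b) ltac:(rewrite size_cat; lia).
rewrite subr_eq => /eqP ->.
rewrite [RHS]addrA [X in _ = X + _]addrC; congr (_ + _).
by apply: eq_sum_splits => ? ? ? _; apply: eq_brlin => ?; rewrite -!catA.
Qed.

(** Interchanging [x] and [y] commutes with carrying [m] across [a] when [x]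
    and [y] stay to the right of both, since the brackets are taken at
    disjoint places. *)
Lemma crossing_swap_right u a m b x y c : (size u + size a + size b + size c).+2 = n ->
  crossing f u a m (b ++ x :: y :: c) - crossing f u a m (b ++ y :: x :: c) =
  brlin (fun z => crossing e u a m (b ++ z :: c)) x y.
Proof.
move=> hn; rewrite /crossing -sum_splitsB brlin_sum_splits.
apply: eq_sum_splits => a1 t a2 ea; rewrite -brlinB -exchange_brlin;
  apply: eq_brlin => z.
have := @fR (u ++ a1 ++ z :: a2 ++ b) x y c.
rewrite -?catA /= -?catA => ->; last first.
  by move: hn; rewrite ea ?size_cat /= ?size_cat /= ?size_cat; lia.
by apply: eq_brlin => z'; rewrite -?catA /= -?catA.
Qed.

(** Here [m] crosses [x] and [y] themselves.  The terms in which [m] is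
    bracketed with [x] or with [y] add up, by the Jacobi identity, to the term
    in which it is bracketed with [[x, y]]. *)
Lemma crossing_swap u p x y q m b :
  (size u + size p + size q + size b).+2 = n ->
  crossing f u (p ++ x :: y :: q) m b - crossing f u (p ++ y :: x :: q) m b =
  brlin (fun z => crossing e u (p ++ z :: q) m b) x y.
Proof.
move=> hn; rewrite /crossing !sum_splits_cat /= !cats0.
under [RHS]eq_brlin do rewrite sum_splits_cat /= cats0.
rewrite !brlinD !opprD addrACA -sum_splitsB; congr (_ + _).
  rewrite brlin_sum_splits; apply: eq_sum_splits => a1 t a2 ea.
  rewrite -brlinB -exchange_brlin; apply: eq_brlin => z.
  have := @fR (u ++ a1 ++ z :: a2) x y (q ++ b).
  rewrite -?catA /= -?catA /= => ->; last first.
    by move: hn; rewrite ea ?size_cat /= ?size_cat /= ?size_cat; lia.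
  by apply: eq_brlin => z'; rewrite -?catA /= -?catA.
have hJ := brlinJ x y m (eA (u ++ p) (q ++ b)).
have E1 : brlin (fun z => f (u ++ p ++ [:: z, y & q ++ b])) x m -
    brlin (fun z => f (u ++ (p ++ [:: y]) ++ z :: q ++ b)) x m =
    brlin (fun z => brlin (fun t => e ((u ++ p) ++ t :: q ++ b)) z y) x m.
  rewrite -brlinB; apply: eq_brlin => z; rewrite -(@fR (u ++ p)) -?catA //=.
  by rewrite !size_cat; lia.
have E2 : brlin (fun z => f (u ++ (p ++ [:: x]) ++ z :: q ++ b)) y m -
    brlin (fun z => f (u ++ p ++ [:: z, x & q ++ b])) y m =
    brlin (fun z => brlin (fun t => e ((u ++ p) ++ t :: q ++ b)) x z) y m.
  rewrite -brlinB; apply: eq_brlin => z; rewrite -(@fR (u ++ p)) -?catA //=.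
  by rewrite !size_cat; lia.
(* pair the bracket with x in both words, then the bracket with y *)
rewrite [LHS](AC ((1*2)*(1*2)) ((1*5)*(2*4)*(3*6))) /= E1 E2 hJ.
congr (_ + _); first by apply: eq_brlin => z; apply: eq_brlin => t; rewrite -catA.
rewrite -sum_splitsB brlin_sum_splits; apply: eq_sum_splits => a1 t a2 ea.
rewrite -brlinB -exchange_brlin; apply: eq_brlin => z.
have := @fR (u ++ p) x y (a1 ++ z :: a2 ++ b).
rewrite -?catA /= -?catA /= => ->; last first.
  by move: hn; rewrite ea ?size_cat /= ?size_cat /= ?size_cat; lia.
by apply: eq_brlin => z'; rewrite -?catA /= -?catA.
Qed.

Lemma crossing_rcons u p x y q : crossing f u (p ++ [:: x]) y q =
  crossing f u p y (x :: q) + brlin (fun z => f (u ++ p ++ z :: q)) x y.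
Proof.
rewrite /crossing sum_splits_cat /= addr0 cats0; congr (_ + _).
by apply: eq_sum_splits => a t b _; apply: eq_brlin => z; rewrite -catA.
Qed.

(** The average has the commutation relation one level up, because each of
    the [k] choices of the letter to be moved first contributes the same
    amount [T].  A letter of [p] or [q] is moved across the same letters in
    both words, and induction applies.  If [x] or [y] is moved, the same word
    remains in both cases, while one of the two moves crosses the other
    letter, which gives [T] directly or by skew-symmetry. *)
Lemma sort_avg_swap k u p x y q : k = (size p + size q).+2 -> (size u + k)%N = n.+1 ->
  sort_avg f k u (p ++ x :: y :: q) - sort_avg f k u (p ++ y :: x :: q) =
  brlin (fun z => f (u ++ p ++ z :: q)) x y.
Proof.
elim: k u p q => [//|k IH] u p q hk hn /=.
rewrite -scalerBr !sum_splits_cat /= !cats0 -!cats1 -!catA /=.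
set T := brlin _ x y.
have Ep a m b : p = a ++ m :: b ->
    crossing f u a m (b ++ x :: y :: q) + sort_avg f k (rcons u m) (a ++ b ++ x ::
      y :: q)
    - (crossing f u a m (b ++ y :: x :: q)
       + sort_avg f k (rcons u m) (a ++ b ++ y :: x :: q)) = T.
  move=> ep; have sp : size p = (size a + size b).+1 by rewrite ep size_cat addnS.
  rewrite opprD addrACA crossing_swap_right; last lia.
  rewrite !catA IH; first last.
  - by rewrite size_rcons; lia.
  - by rewrite size_cat; lia.
  rewrite -brlinD; apply: eq_brlin => z; rewrite ep -cats1 -!catA /=.
  rewrite addrC -crossingE //; last by rewrite size_cat /=; lia.
have Eq a m b : q = a ++ m :: b ->
    crossing f u (p ++ x :: y :: a) m b + sort_avg f k (rcons u m) (p ++ x :: y ::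
      a ++ b)
    - (crossing f u (p ++ y :: x :: a) m b
       + sort_avg f k (rcons u m) (p ++ y :: x :: a ++ b)) = T.
  move=> eq; have sq : size q = (size a + size b).+1 by rewrite eq size_cat addnS.
  rewrite opprD addrACA crossing_swap; last lia.
  rewrite IH; first last.
  - by rewrite size_rcons; lia.
  - by rewrite size_cat; lia.
  rewrite -brlinD; apply: eq_brlin => z; rewrite eq -cats1 -!catA /=.
  have := @crossingE u (p ++ z :: a) m b; rewrite -!catA /= => ->; first exact: addrC.
  by rewrite size_cat /=; lia.
rewrite [X in _ *: X](_ : _ = T *+ k.+1).
  by rewrite -scaler_nat scalerA mulVf ?scale1r // natF_neq0.
have TC : brlin (fun z => f (u ++ p ++ z :: q)) y x = - T.
  have := brlinC y x (fA (u ++ p) q).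
  rewrite (@eq_brlin _ (fun z => f (u ++ p ++ z :: q))) => [->|z];
    last by rewrite -catA.
  by congr (- _); apply: eq_brlin => z; rewrite -catA.
rewrite !crossing_rcons TC -/T.
set Sp := sum_splits _ p; set Sp' := (X in _ - (X + _)).
set Sq := (X in Sp + (_ + (_ + X))).
set Sq' := (X in _ - (_ + (_ + (_ + X)))).
set m1 := crossing f u p x _; set m2 := crossing f u p y _.
set a1 := sort_avg f k (u ++ [:: x]) _; set a2 := sort_avg f k (u ++ [:: y]) _.
have eSp : Sp - Sp' = T *+ size p.
  by rewrite -sum_splitsB -(sum_splits_const T p); apply: eq_sum_splits.
have eSq : Sq - Sq' = T *+ size q.
  rewrite -sum_splitsB -(sum_splits_const T q); apply: eq_sum_splits => a m b e1.
  by rewrite -!catA /= Eq.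
(* group every summand with its counterpart for the other word *)
rewrite !opprD opprK.
rewrite [LHS](AC ((1*((1*1)*(((1*1)*1)*1)))*(1*((1*1)*(((1*1)*1)*1))))
  (((1*8)*(7*14)*(5*12))*((2*11)*(3*13)*(4*9)*(6*10)))) /=.
rewrite eSp eSq !subrr !addr0 -mulr2n -!mulrnDr; congr (_ *+ _); lia.
Qed.

End Step.

(** The projection is defined on the enveloping algebra: a commutator of two
    letters has the same value as their bracket. *)
Lemma pbw_proj_swap u x y v :
  pbw_proj (u ++ x :: y :: v) - pbw_proj (u ++ y :: x :: v) =
  brlin (fun z => pbw_proj (u ++ z :: v)) x y.
Proof.
suff fR n u' x' y' v' : (size u' + size v').+2 = n ->
    pbw_level n (u' ++ x' :: y' :: v') - pbw_level n (u' ++ y' :: x' :: v') =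
    brlin (fun z => pbw_level n.-1 (u' ++ z :: v')) x' y'.
  rewrite /pbw_proj !size_cat /= addnS fR //; last by rewrite addnS.
  by apply: eq_brlin => z; rewrite size_cat.
elim: n u' x' y' v' => [//|n IH] {}u {}x {}y {}v hn.
have pE z t : pbw_level n.+1 (u ++ z :: t :: v) =
  sort_avg (pbw_level n) n.+1 [::] (u ++ z :: t :: v).
  by case: (u) => [|? []].
rewrite !pE (sort_avg_swap (n:=n) (e:=pbw_level n.-1)) //;
  first exact: slotwise_pbw_level.
by apply: slotwise_pbw_level.
Qed.

Lemma pbw_proj1 x : pbw_proj [:: x] = eps x. Proof. by []. Qed.

End PBW.

(** * Double sequences and locality *)
Section Binz.
Variable F : fieldType.
Hypothesis natF_neq0 : forall n, (n.+1%:R : F) != 0.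

(** Binomial coefficients [m choose s] for a possibly negative [m]. *)
Definition binz (m : int) (s : nat) : F :=
  (\prod_(i < s) (m - i%:Z)%:~R) / s`!%:R.

Lemma factF_neq0 s : (s`!%:R : F) != 0.
Proof. by case: s`! (fact_gt0 s) => // n _; apply: natF_neq0. Qed.

Lemma binz0 m : binz m 0 = 1.
Proof. by rewrite /binz big_ord0 fact0 divr1. Qed.

Lemma binz0S s : binz 0 s.+1 = 0.
Proof. by rewrite /binz big_ord_recl /= subr0 mul0r mul0r. Qed.

Lemma binz_absorb m s : s.+1%:R * binz m s.+1 = m%:~R * binz (m - 1) s.
Proof.
rewrite /binz big_ord_recl factS natrM /= subr0.
have -> : \prod_(i < s) (m - (bump 0 i)%:Z)%:~R =
          \prod_(i < s) (m - 1 - i%:Z)%:~R :> F.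
  by apply: eq_bigr => i _; congr (_%:~R); rewrite /bump /=; lia.
by field; rewrite factF_neq0 nat1r natF_neq0.
Qed.

Lemma binzS m s : binz (m + 1) s.+1 = binz m s.+1 + binz m s.
Proof.
apply: (mulfI (natF_neq0 s)); rewrite binz_absorb addrK.
rewrite /binz big_ord_recr factS natrM /= rmorphB rmorphD /=.
by field; rewrite factF_neq0 nat1r natF_neq0.
Qed.

End Binz.

Section Delta.
Variables (F : fieldType) (W : lmodType F).
Implicit Types (Y Z : int -> int -> W).

(** A double sequence is a formal distribution in [z] and [w]; the coefficient
    at [(i, j)] belongs to [z^(-i-1) w^(-j-1)].  Multiplication by [z - w]
    acts as [zdiff], and taking the residue in [z] is evaluation at [i = 0]. *)
Definition zdiff Y : int -> int -> W := fun i j => Y (i + 1) j - Y i (j + 1).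

Lemma iter_zdiffP n k Y Z i j :
  iter n zdiff (fun i j => k *: Y i j + Z i j) i j =
  k *: iter n zdiff Y i j + iter n zdiff Z i j.
Proof.
elim: n i j => //= n IH i j; rewrite /zdiff !IH scalerBr opprD.
by rewrite addrACA.
Qed.

Lemma iter_zdiff0 n i j : iter n zdiff (fun _ _ => 0) i j = 0.
Proof. by elim: n i j => //= n IH i j; rewrite /zdiff !IH subr0. Qed.

Lemma eq_iter_zdiff n Y Z : (forall i j, Y i j = Z i j) ->
  forall i j, iter n zdiff Y i j = iter n zdiff Z i j.
Proof. by move=> e; elim: n => //= n IH i j; rewrite /zdiff !IH. Qed.

Lemma iter_zdiffD n Y Z i j :
  iter n zdiff (fun i j => Y i j + Z i j) i j =
  iter n zdiff Y i j + iter n zdiff Z i j.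
Proof.
rewrite -[in RHS](scale1r (iter n zdiff Y i j)) -iter_zdiffP.
by apply: eq_iter_zdiff => ? ?; rewrite scale1r.
Qed.

Lemma iter_zdiffN n Y i j :
  iter n zdiff (fun i j => - Y i j) i j = - iter n zdiff Y i j.
Proof.
rewrite -[RHS]addr0 -(iter_zdiff0 n i j) -scaleN1r -iter_zdiffP.
by apply: eq_iter_zdiff => ? ?; rewrite scaleN1r addr0.
Qed.

Lemma iter_zdiffB n Y Z i j :
  iter n zdiff (fun i j => Y i j - Z i j) i j =
  iter n zdiff Y i j - iter n zdiff Z i j.
Proof. by rewrite iter_zdiffD iter_zdiffN. Qed.

Lemma iter_zdiff_swap n Y i j :
  iter n zdiff (fun i j => Y j i) i j = (-1) ^+ n *: iter n zdiff Y j i.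
Proof.
elim: n i j => [|n IH] i j /=; first by rewrite scale1r.
by rewrite /zdiff !IH -scalerBr -opprB exprS -scalerA scaleN1r scalerN.
Qed.

Definition vanish_from N Y := forall n i j, (N <= n)%N -> iter n zdiff Y i j = 0.

Hypothesis natF_neq0 : forall n, (n.+1%:R : F) != 0.

(** The distribution [sum_(t < B) h_t(w) delta^(t)(z - w) / t!]. *)
Definition delta_sum (h : nat -> int -> W) B : int -> int -> W :=
  fun i j => \sum_(0 <= t < B) binz F i t *: h t (i + j - t%:Z).

Lemma zdiff_delta_sum h B i j : (forall t, (B <= t)%N -> forall k, h t k = 0) ->
  zdiff (delta_sum h B) i j = delta_sum (fun t => h t.+1) B i j.
Proof.
move=> hB; case: B hB => [|B] hB; first by rewrite /zdiff /delta_sum !big_geq ?subr0.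
rewrite /zdiff /delta_sum -sumrB.
under eq_bigr do rewrite (addrAC i 1 j) (addrA i j 1) -scalerBl.
rewrite big_nat_recl // !binz0 subrr scale0r add0r.
rewrite [RHS]big_nat_recr //= hB // scaler0 addr0.
apply: eq_bigr => t _; rewrite binzS // [_ + _ - _]addrAC subrr add0r.
by congr (_ *: h _ _); lia.
Qed.

Lemma iter_zdiff_delta_sum n h B i j :
  (forall t, (B <= t)%N -> forall k, h t k = 0) ->
  iter n zdiff (delta_sum h B) i j = delta_sum (fun t => h (t + n)%N) B i j.
Proof.
move=> hB; elim: n i j => [|n IH] i j /=.
  by apply: eq_bigr => t _; rewrite addn0.
rewrite /zdiff !IH -/(zdiff (delta_sum (fun t => h (t + n)%N) B) i j) zdiff_delta_sum.
  by apply: eq_bigr => t _; rewrite addnS.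
by move=> t ht k; apply: hB; lia.
Qed.

Lemma delta_sum0 h B k : (forall t, (B <= t)%N -> forall k, h t k = 0) ->
  delta_sum h B 0 k = h 0%N k.
Proof.
move=> hB; case: B hB => [|B] hB; first by rewrite /delta_sum big_geq // hB.
rewrite /delta_sum big_nat_recl // binz0 scale1r big1 ?addr0.
  by congr (h _ _); lia.
by move=> t _; rewrite binz0S scale0r.
Qed.

Lemma delta_sum_coef n h B k :
  (forall t, (B <= t)%N -> forall k, h t k = 0) ->
  iter n zdiff (delta_sum h B) 0 k = h n k.
Proof.
move=> hB; rewrite iter_zdiff_delta_sum // delta_sum0 // => t ht k'.
by apply: hB; lia.
Qed.

Lemma vanish_delta_sum h B : (forall t, (B <= t)%N -> forall k, h t k = 0) ->
  vanish_from B (delta_sum h B).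
Proof.
move=> hB n i j hn; rewrite iter_zdiff_delta_sum // /delta_sum big1 // => t _.
by rewrite hB ?scaler0 //; lia.
Qed.

(** If [(z - w) Y = 0] then [Y] is constant along antidiagonals. *)
Lemma eq0_of_zdiff Y : (forall i j, zdiff Y i j = 0) -> (forall k, Y 0 k = 0) ->
  forall i j, Y i j = 0.
Proof.
move=> hD h0 i j.
have step i' j' : Y (i' + 1) j' = Y i' (j' + 1).
  by apply/eqP; rewrite -subr_eq0; apply/eqP/hD.
case: (intP i) => [|n|n]; first exact: h0.
- elim: n.+1 j => {}n // IH j.
  by rewrite -addn1 PoszD step IH.
- elim: n.+1 j => {}n // IH j.
  have -> : j = (j - 1) + 1 by rewrite subrK.
  rewrite -step; have -> : - n.+1%:Z + 1 = - n%:Z by lia.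
  exact: IH.
Qed.

(** A local distribution is determined by the residues of its products with
    the powers of [z - w].  This is how identities between distributions are
    reduced below to identities between the products of a conformal algebra. *)
Lemma local_uniq Y N : vanish_from N Y ->
  (forall n k, iter n zdiff Y 0 k = 0) -> forall i j, Y i j = 0.
Proof.
elim: N Y => [|N IH] Y hN h0; first by move=> i j; apply: (hN 0%N).
apply: eq0_of_zdiff; last exact: (h0 0%N).
apply: IH => [n i j hn|n k]; rewrite -iterSr.
  exact: hN.
exact: h0.
Qed.

(** The decomposition of a local distribution into derivatives of the delta
    function. *)
Lemma local_expand Y N : vanish_from N Y -> forall i j,
  Y i j = \sum_(0 <= s < N) binz F i s *: iter s zdiff Y 0 (i + j - s%:Z).
Proof.
move=> hN i j; pose h s k := iter s zdiff Y 0 k.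
have hB t : (N <= t)%N -> forall k, h t k = 0 by move=> ht k; apply: hN.
apply/eqP; rewrite -subr_eq0; apply/eqP.
apply: (@local_uniq (fun i j => Y i j - delta_sum h N i j) N) => [n i' j' hn|n k].
  by rewrite iter_zdiffB hN // vanish_delta_sum // subr0.
by rewrite iter_zdiffB delta_sum_coef // subrr.
Qed.

End Delta.

(** Linear maps act on coefficients and so commute with [zdiff]. *)
Lemma iter_zdiff_ev (F : fieldType) (U W : lmodType F) (g : U -> W) n
    (Y : int -> int -> U) i j : (forall x y, g (x - y) = g x - g y) ->
  g (iter n (@zdiff F U) Y i j) = iter n (@zdiff F W) (fun i j => g (Y i j)) i j.
Proof. by move=> h; elim: n i j => //= n IH i j; rewrite /zdiff h !IH. Qed.

Section IterBin.
Variables (F : fieldType) (U : lmodType F) (P Q : U -> U).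
Hypotheses (Pl : linear P) (Ql : linear Q).
Hypothesis PQ : forall h, P (Q h) = Q (P h).

Lemma iter_sub_comm m h : iter m (fun h => P h - Q h) h =
  \sum_(s < m.+1)
     ((-1) ^+ s * 'C(m, s)%:R : F) *: iter (m - s) P (iter s Q h).
Proof.
pose PL := GRing.isLinear.Build F U U *:%R P Pl.
pose QL := GRing.isLinear.Build F U U *:%R Q Ql.
pose P' : {linear U -> U} := HB.pack P PL.
pose Q' : {linear U -> U} := HB.pack Q QL.
have iQ s x : P (iter s Q x) = iter s Q (P x).
  by elim: s => //= s <-; rewrite PQ.
elim: m => [|m IH]; first by rewrite big_ord1 /= bin0 mulr1 scale1r.
rewrite iterS IH.
pose c n s : F := (-1) ^+ s * 'C(n, s)%:R.
pose T n s := iter (n - s) P (iter s Q h).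
rewrite -[P _]/(P' _) -[Q _]/(Q' _) !linear_sum /=.
have -> : \sum_(s < m.+1) P (c m s *: T m s) =
    \sum_(s < m.+2) c m s *: T m.+1 s.
  rewrite [RHS]big_ord_recr /= {3}/c bin_small // mulr0n mulr0 scale0r addr0.
  by apply: eq_bigr => s _; rewrite -[P _]/(P' _) linearZ /T subSn // -ltnS.
rewrite sumrN.
have -> : \sum_(s < m.+1) Q (c m s *: T m s) =
    \sum_(s < m.+1) c m s *: T m.+1 s.+1.
  apply: eq_bigr => s _; rewrite -[Q _]/(Q' _) linearZ /= /T subSS.
  by congr (_ *: _); elim: (m - s)%N => //= n <-; rewrite PQ.
rewrite big_ord_recl [RHS]big_ord_recl -addrA; congr (_ + _).
  by rewrite /c !bin0.
rewrite -sumrB; apply: eq_bigr => s _; rewrite -scalerBl /= /bump /= add1n.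
congr (_ *: _); rewrite /c binS natrD exprS; ring.
Qed.
End IterBin.

(** * Three variables *)
Section Delta3.
Variables (F : fieldType) (W : lmodType F).
Notation fun3 := (int -> int -> int -> W).
Implicit Types (Y Z : fun3).

(** Multiplication by [z_1 - z_2], [z_1 - z_3] and [z_2 - z_3]. *)
Definition d12 Y : fun3 := fun i j k => Y (i + 1) j k - Y i (j + 1) k.
Definition d13 Y : fun3 := fun i j k => Y (i + 1) j k - Y i j (k + 1).
Definition d23 Y : fun3 := fun i j k => Y i (j + 1) k - Y i j (k + 1).

Lemma iter_d12 n Y i j k :
  iter n d12 Y i j k = iter n (@zdiff F W) (fun i j => Y i j k) i j.
Proof. by elim: n i j => //= n IH i j; rewrite /d12 /zdiff !IH. Qed.

Lemma iter_d13 n Y i j k :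
  iter n d13 Y i j k = iter n (@zdiff F W) (fun i k => Y i j k) i k.
Proof. by elim: n i k => //= n IH i k; rewrite /d13 /zdiff !IH. Qed.

Lemma iter_d23 n Y i j k :
  iter n d23 Y i j k = iter n (@zdiff F W) (Y i) j k.
Proof. by elim: n j k => //= n IH j k; rewrite /d23 /zdiff !IH. Qed.

Lemma fun3P Y Z : (forall i j k, Y i j k = Z i j k) -> Y = Z.
Proof. by move=> e; do 3!apply/funext => ?. Qed.

Lemma d13_linear : linear d13.
Proof.
move=> x Y Z; apply: fun3P => i j k.
by rewrite /d13 !fctE /= scalerBr opprD addrACA.
Qed.

Lemma d23_linear : linear d23.
Proof.
move=> x Y Z; apply: fun3P => i j k.
by rewrite /d23 !fctE /= scalerBr opprD addrACA.
Qed.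

Lemma d1323 Y : d13 (d23 Y) = d23 (d13 Y).
Proof.
apply: fun3P => i j k; rewrite /d13 /d23 !opprB.
by rewrite (AC (2*2) ((1*4)*(3*2))) /=.
Qed.

Lemma iter_d1323 p q Y : iter p d13 (iter q d23 Y) = iter q d23 (iter p d13 Y).
Proof.
have h Z : d13 (iter q d23 Z) = iter q d23 (d13 Z).
  by elim: q => //= q <-; rewrite d1323.
by elim: p => //= p ->; rewrite h.
Qed.

(** Binomial expansion of [(z_1 - z_2)^m = ((z_1 - z_3) - (z_2 - z_3))^m]. *)
Lemma iter_d12E m Y : iter m d12 Y = \sum_(s < m.+1)
  ((-1) ^+ s * 'C(m, s)%:R : F) *: iter (m - s) d13 (iter s d23 Y).
Proof.
rewrite -(iter_sub_comm d13_linear d23_linear d1323).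
apply: eq_iter => {}Y; apply: fun3P => i j k.
rewrite /d12 !fctE /= /d13 /d23 opprB.
by rewrite addrA subrK.
Qed.

(** The coefficients on the right are those of the conformal associativity
    and Jacobi identities, which both come from this expansion. *)
Lemma iter_d2312 n m Y : iter n d23 (iter m d12 Y) = \sum_(s < m.+1)
  ((-1) ^+ s * 'C(m, s)%:R : F) *: iter (m - s) d13 (iter (n + s) d23 Y).
Proof.
pose D := GRing.isLinear.Build F fun3 fun3 *:%R d23 d23_linear.
pose D' : {linear fun3 -> fun3} := HB.pack d23 D.
have lin c Z : iter n d23 (c *: Z) = c *: iter n d23 Z.
  by elim: n => //= n ->; rewrite -[d23]/(D' : _ -> _) linearZ.
rewrite iter_d12E.
transitivity (\sum_(s < m.+1) iter n d23
    (((-1) ^+ s * 'C(m, s)%:R : F) *: iter (m - s) d13 (iter s d23 Y))).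
  elim: n {lin} => //= n ->; rewrite -[d23]/(D' : _ -> _) linear_sum; done.
by apply: eq_bigr => s _; rewrite lin -iter_d1323 iterD.
Qed.

Lemma sum_fun3E (I : Type) (r : seq I) (G : I -> fun3) i j k :
  (\sum_(s <- r) G s) i j k = \sum_(s <- r) G s i j k.
Proof.
elim: r => [|x r IH]; first by rewrite !big_nil.
by rewrite !big_cons -IH.
Qed.

Lemma iter_d2312_at n m Y i j k : iter n d23 (iter m d12 Y) i j k =
  \sum_(s < m.+1) ((-1) ^+ s * 'C(m, s)%:R : F) *:
     iter (m - s) d13 (iter (n + s) d23 Y) i j k.
Proof. by rewrite iter_d2312 sum_fun3E. Qed.

End Delta3.

Section DeltaD.
Variables (F : fieldType) (W : lmodType F).
Implicit Types (Y : int -> int -> W).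

(** Leibniz rule for multiplication by [(z - w)^n] and differentiation in
    [z]; the next lemma is the same for [w]. *)
Lemma iter_zdiff_D1 n Y i j :
  iter n (@zdiff F W) (fun i j => - (i%:~R *: Y (i - 1) j)) i j =
  - (i%:~R *: iter n (@zdiff F W) Y (i - 1) j) - iter n.-1 (@zdiff F W) Y i j *+ n.
Proof.
elim: n Y i j => [|n IH] Y i j; first by rewrite /= mulr0n subr0.
rewrite iterSr (@eq_iter_zdiff _ _ _ _ (fun i j => (fun i j =>
  - (i%:~R *: zdiff Y (i - 1) j)) i j - Y i j)); last first.
  move=> {}i {}j; rewrite /zdiff addrK subrK rmorphD /= scalerDl scale1r scalerBr.
  by rewrite !opprD !opprK addrAC.
rewrite iter_zdiffB IH -iterSr -addrA -opprD; congr (_ - _).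
by case: n {IH} => [|n]; rewrite ?mulr0n ?add0r // -iterSr [RHS]mulrSr.
Qed.

Lemma iter_zdiff_D2 n Y i j :
  iter n (@zdiff F W) (fun i j => - (j%:~R *: Y i (j - 1))) i j =
  - (j%:~R *: iter n (@zdiff F W) Y i (j - 1)) + iter n.-1 (@zdiff F W) Y i j *+ n.
Proof.
elim: n Y i j => [|n IH] Y i j; first by rewrite /= mulr0n addr0.
rewrite iterSr (@eq_iter_zdiff _ _ _ _ (fun i j => (fun i j =>
  - (j%:~R *: zdiff Y i (j - 1))) i j + Y i j)); last first.
  move=> {}i {}j; rewrite /zdiff addrK subrK rmorphD /= scalerDl scale1r scalerBr.
  by rewrite !opprD !opprK addrA.
rewrite iter_zdiffD IH -iterSr -addrA; congr (_ + _).
by case: n {IH} => [|n]; rewrite ?mulr0n ?add0r // -iterSr [RHS]mulrSr.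
Qed.

End DeltaD.

(** * Formal distributions over an associative algebra *)
Section Fields.
Variables (F : fieldType) (R : lmodType F) (mul : R -> R -> R).
Hypothesis mul_linearl : forall b, linear (mul^~ b).
Hypothesis mul_linearr : forall a, linear (mul a).
Hypothesis mulA : associative mul.
Notation fld := (int -> R).
Notation zdiff := (@zdiff F R).
Implicit Types (a b c : fld).

(** A function [a : int -> R] is the distribution with coefficients [a n] at
    [z^(-n-1)]; then [fpair a b] is [a(z) b(w)], [fldprod n a b] is the
    residue of [(z - w)^n a(z) b(w)] in [z], and [fderiv] is differentiation. *)
Definition fpair a b : int -> int -> R := fun i j => mul (a i) (b j).
Definition fldprod (n : nat) a b : fld := fun k => iter n zdiff (fpair a b) 0 k.
Definition fderiv a : fld := fun k => - (k%:~R *: a (k - 1)).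

(** Stronger than the vanishing of all products [fldprod n a b] with large
    [n], which says nothing about negative [i]. *)
Definition flocal a b := exists N, vanish_from N (fpair a b).

Lemma fderiv_linear : linear fderiv.
Proof.
move=> x a b; apply/funext => k; rewrite /fderiv !fctE /=.
by rewrite scalerDr opprD scalerN !scalerA mulrC.
Qed.

Lemma fpairPl x a b c i j : fpair (x *: a + b) c i j =
  x *: fpair a c i j + fpair b c i j.
Proof. exact: mul_linearl. Qed.

Lemma fpairPr x a b c i j : fpair a (x *: b + c) i j =
  x *: fpair a b i j + fpair a c i j.
Proof. exact: mul_linearr. Qed.

Lemma fldprod_linearl n b : linear (fun a => fldprod n a b).
Proof.
move=> x a c; apply/funext => k; rewrite /fldprod !fctE /=.
by rewrite -iter_zdiffP; apply: eq_iter_zdiff => i j; apply: fpairPl.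
Qed.

Lemma fldprod_linearr n a : linear (fldprod n a).
Proof.
move=> x b c; apply/funext => k; rewrite /fldprod !fctE /=.
by rewrite -iter_zdiffP; apply: eq_iter_zdiff => i j; apply: fpairPr.
Qed.

Lemma mulZNl x (a b : R) : mul (- (x *: a)) b = - (x *: mul a b).
Proof.
have h := mul_linearl b; have h0 := linear_at0 h.
by rewrite -scaleNr -[_ *: _]addr0 h h0 addr0 scaleNr.
Qed.

Lemma mulZNr x (a b : R) : mul b (- (x *: a)) = - (x *: mul b a).
Proof.
have h := mul_linearr b; have h0 := linear_at0 h.
by rewrite -scaleNr -[_ *: _]addr0 h h0 addr0 scaleNr.
Qed.

Lemma mulBl (x y b : R) : mul (x - y) b = mul x b - mul y b.
Proof.
by rewrite addrC -scaleN1r mul_linearl scaleN1r addrC.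
Qed.

Lemma mulBr (x y b : R) : mul b (x - y) = mul b x - mul b y.
Proof.
by rewrite addrC -scaleN1r mul_linearr scaleN1r addrC.
Qed.

Lemma fpair_derivl a b i j : fpair (fderiv a) b i j = - (i%:~R *: fpair a b (i - 1) j).
Proof. exact: mulZNl. Qed.

Lemma fpair_derivr a b i j : fpair a (fderiv b) i j = - (j%:~R *: fpair a b i (j - 1)).
Proof. exact: mulZNr. Qed.

Lemma fldprod_derivl n a b : fldprod n (fderiv a) b = - (fldprod n.-1 a b *+ n).
Proof.
apply/funext => k; rewrite /fldprod.
rewrite (eq_iter_zdiff n (fpair_derivl a b)) iter_zdiff_D1 scale0r oppr0 add0r.
rewrite -scaler_nat -[in RHS]scaler_nat.
done.
Qed.

Lemma fderiv_prod n a b :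
  fderiv (fldprod n a b) = fldprod n (fderiv a) b + fldprod n a (fderiv b).
Proof.
apply/funext => k; rewrite !fctE /= /fldprod.
rewrite (eq_iter_zdiff n (fpair_derivl a b)) iter_zdiff_D1.
rewrite (eq_iter_zdiff n (fpair_derivr a b)) iter_zdiff_D2.
by rewrite scale0r oppr0 add0r addrCA addNr addr0.
Qed.

(** Both sides are coefficients of [a(z_1) b(z_2) c(z_3)] multiplied by
    [(z_1 - z_2)^m (z_2 - z_3)^n]. *)
Lemma fldprodA m n a b c : fldprod n (fldprod m a b) c =
  \sum_(s < m.+1)
    ((-1) ^+ s * 'C(m, s)%:R : F) *: fldprod (m - s) a (fldprod (n + s) b c).
Proof.
apply/funext => k.
pose Y i j k := mul (mul (a i) (b j)) (c k).
have -> : fldprod n (fldprod m a b) c k = iter n (@d23 F R) (iter m (@d12 F R) Y) 0 0 k.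
  rewrite iter_d23; apply: eq_iter_zdiff => j {}k.
  rewrite iter_d12 /fpair /fldprod (iter_zdiff_ev (g := mul^~ (c k))) // => x y.
  exact: mulBl.
rewrite iter_d2312_at.
rewrite fct_sumE; apply: eq_bigr => s _; rewrite !fctE /=; congr (_ *: _);
  rewrite iter_d13; apply: eq_iter_zdiff => i {}k.
rewrite iter_d23 /fpair /fldprod (iter_zdiff_ev (g := mul (a i))) => [|x y].
  by apply: eq_iter_zdiff => j {}k; rewrite /Y mulA.
exact: mulBr.
Qed.

Lemma flocalPl x a b c : flocal a c -> flocal b c -> flocal (x *: a + b) c.
Proof.
move=> [N hN] [M hM]; exists (maxn N M) => n i j hn.
rewrite (eq_iter_zdiff n (fpairPl x a b c)) iter_zdiffP hN ?hM ?scaler0 ?addr0 //; lia.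
Qed.

Lemma flocalPr x a b c : flocal c a -> flocal c b -> flocal c (x *: a + b).
Proof.
move=> [N hN] [M hM]; exists (maxn N M) => n i j hn.
rewrite (eq_iter_zdiff n (fpairPr x c a b)) iter_zdiffP hN ?hM ?scaler0 ?addr0 //; lia.
Qed.

Lemma flocal_derivl a b : flocal a b -> flocal (fderiv a) b.
Proof.
move=> [N hN]; exists N.+1 => n i j hn.
rewrite (eq_iter_zdiff n (fpair_derivl a b)) iter_zdiff_D1 !hN; [|lia..].
by rewrite scaler0 oppr0 mul0rn subrr.
Qed.

Lemma flocal_derivr a b : flocal a b -> flocal a (fderiv b).
Proof.
move=> [N hN]; exists N.+1 => n i j hn.
rewrite (eq_iter_zdiff n (fpair_derivr a b)) iter_zdiff_D2 !hN; [|lia..].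
by rewrite scaler0 oppr0 mul0rn addr0.
Qed.

Hypothesis natF_neq0 : forall n, (n.+1%:R : F) != 0.

Lemma iter_fderiv s a k : (s`!%:R : F)^-1 *: iter s fderiv a k =
  ((-1) ^+ s * binz F k s) *: a (k - s%:Z).
Proof.
elim: s k => [|s IH] k /=.
  by rewrite fact0 invr1 !scale1r binz0 mulr1 scale1r subr0.
have s1 := natF_neq0 s.
rewrite [X in _ *: X]/fderiv scalerN scalerA factS natrM invfM.
rewrite [X in - (X *: _)](_ : _ = s.+1%:R^-1 * k%:~R * (s`!%:R)^-1); last by ring.
rewrite -[in LHS]scalerA IH scalerA -scaleNr; congr (_ *: a _); last lia.
have := binz_absorb natF_neq0 k s.
move/(canRL (mulKf s1)) => ->; rewrite exprS; ring.
Qed.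

(** The sum that defines the opposite product of a conformal algebra is the
    residue of [(z - w)^n b(w) a(z)] in [z], by the expansion of a local
    distribution. *)
Lemma fopp_expand n a b N k : vanish_from N (fpair b a) ->
  \sum_(0 <= s < N)
    ((-1) ^+ (n + s) : F) *: ((s`!%:R : F)^-1 *: iter s fderiv (fldprod (n + s) b
      a) k) =
  iter n zdiff (fun i j => fpair b a j i) 0 k.
Proof.
move=> hN; rewrite iter_zdiff_swap.
have hN' : vanish_from N (iter n zdiff (fpair b a)).
  by move=> m i j hm; rewrite -iterD hN //; lia.
rewrite (local_expand natF_neq0 hN') scaler_sumr; apply: eq_bigr => s _.
rewrite iter_fderiv !scalerA /fldprod addr0 (addnC n s) iterD; congr (_ *: _).
by rewrite exprD [_ * (-1) ^+ n]mulrC -mulrA; congr (_ * _);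
  rewrite mulrA -expr2 sqrr_sign mul1r.
Qed.

End Fields.

(** * Associative conformal algebras of distributions *)
Section Submodule.
Variables (F : fieldType) (V : lmodType F) (S : V -> Prop).

Definition submod_prop := S 0 /\ forall k x y, S x -> S y -> S (k *: x + y).

(** The closure proof is a parameter so that the module structure can be
    attached to the type. *)
Definition submod (h : submod_prop) : Type := {x : V | `[<S x>]}.

Variable h : submod_prop.

Let p : pred V := fun x => `[<S x>].

Lemma submod_closed_asbool : subsemimod_closed p.
Proof.
case: h => S0 SP; split; [split|] => [|x y|k x]; rewrite /p ?unfold_in.
- exact/asboolP.
- move=> /asboolP hx /asboolP hy; apply/asboolP.
  by rewrite -[x]scale1r; apply: SP.
- by move=> /asboolP hx; apply/asboolP; rewrite -[_ *: _]addr0; apply: SP.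
Qed.

HB.instance Definition _ := SubType.copy (submod h) {x : V | p x}.
HB.instance Definition _ := [Choice of submod h by <:].
HB.instance Definition _ := GRing.SubChoice_isSubLmodule.Build F V p (submod h)
  submod_closed_asbool.

Lemma submodP (x : submod h) : S (val x).
Proof. exact/asboolP/(valP x). Qed.

Definition submodS x (hx : S x) : submod h := Sub x (asboolT hx).

End Submodule.

Section FieldAlgebra.
Variables (F : fieldType) (R : lmodType F) (mul : R -> R -> R).
Hypothesis mul_linearl : forall b, linear (mul^~ b).
Hypothesis mul_linearr : forall a, linear (mul a).
Hypothesis mulA : associative mul.
Variable S : (int -> R) -> Prop.
Hypothesis Slin : submod_prop S.
Hypothesis SD : forall a, S a -> S (fderiv a).
Hypothesis SM : forall n a b, S a -> S b -> S (fldprod mul n a b).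
Hypothesis Sloc : forall a b, S a -> S b -> flocal mul a b.

Notation A := (submod Slin).

Let Aderiv (a : A) : A := submodS Slin (SD (submodP (h:=Slin) a)).
Let Aprod n (a b : A) : A := submodS Slin (SM n (submodP (h:=Slin) a) (submodP
  (h:=Slin) b)).

Fact Aderiv_linear : linear Aderiv.
Proof.
by move=> k x y; apply: val_inj; rewrite /= fderiv_linear.
Qed.

Fact Aprod_linearl n b : linear (fun a => Aprod n a b).
Proof.
by move=> k x y; apply: val_inj; rewrite /= fldprod_linearl.
Qed.

Fact Aprod_linearr n a : linear (Aprod n a).
Proof.
by move=> k x y; apply: val_inj; rewrite /= fldprod_linearr.
Qed.

Fact Aprod_local a b : exists N, forall n, (N <= n)%N -> Aprod n a b = 0.
Proof.
have [N hN] := Sloc (submodP (h:=Slin) a) (submodP (h:=Slin) b).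
by exists N => n hn; apply: val_inj; apply/funext => k; apply: hN.
Qed.

Fact Aderiv_prod n a b :
  Aderiv (Aprod n a b) = Aprod n (Aderiv a) b + Aprod n a (Aderiv b).
Proof. by apply: val_inj; rewrite /= fderiv_prod. Qed.

Fact Aprod_derivl n a b : Aprod n (Aderiv a) b = - (Aprod n.-1 a b *+ n).
Proof. by apply: val_inj; rewrite raddfN raddfMn /= fldprod_derivl. Qed.

Let AC := isConformalAlgebra.Build F A Aderiv_linear Aprod_linearl Aprod_linearr
  Aprod_local Aderiv_prod Aprod_derivl.
Let A1 : conformalAlgType F := HB.pack A AC.

Fact AprodA m n (a b c : A1) : (a *[m] b) *[n] c =
    \sum_(s < m.+1)
      ((-1) ^+ s * 'C(m, s)%:R : F) *: (a *[m - s] (b *[n + s] c)).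
Proof.
have vsum (f : 'I_m.+1 -> A) : val (\sum_(s < m.+1) f s) =
    \sum_(s < m.+1) val (f s) by rewrite raddf_sum.
apply: val_inj; rewrite [RHS]vsum /= fldprodA //.
Qed.

Let AA := isAssocConformal.Build F A1 AprodA.
Let A2 : assocConformalAlgType F := HB.pack A1 AA.

(** Distributions which are pairwise local and closed under the operations
    form an associative conformal algebra.  The algebra is only accessible
    through its embedding into the distributions. *)
Theorem field_algebra : exists (A : assocConformalAlgType F)
  (iota : A -> (int -> R)),
  [/\ linear iota, injective iota,
   (forall x, S (iota x)) /\ (forall a, S a -> exists x, iota x = a),
   forall x, iota (cderiv x) = fderiv (iota x) &
   forall n x y, iota (x *[n] y) = fldprod mul n (iota x) (iota y)].
Proof.
exists A2, (val : A -> _); split=> //.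
- apply: conj => [x|a Sa]; first exact: (@submodP _ _ _ Slin x).
  by exists (submodS Slin Sa).
Qed.

End FieldAlgebra.

Section FieldMinus.
Variables (F : fieldType) (pcharF : [pchar F] =i pred0).
Variables (R : lmodType F) (mul : R -> R -> R).
Variables (A : assocConformalAlgType F) (iota : A -> (int -> R)).
Hypothesis iotaL : linear iota.
Hypothesis iotaD : forall x, iota (cderiv x) = fderiv (iota x).
Hypothesis iotaM : forall n x y, iota (x *[n] y) = fldprod mul n (iota x) (iota y).
Hypothesis iota_loc : forall x y, flocal mul (iota x) (iota y).

(** In the Lie conformal algebra attached to such an algebra, the bracket is
    the residue of [(z - w)^n] times the commutator of the distributions. *)
Lemma iota_minus n (x y : cminus pcharF A) k :
  iota (x *[n] y) k = iter n (@zdiff F R)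
    (fun i j => mul (iota x i) (iota y j) - mul (iota y j) (iota x i)) 0 k.
Proof.
pose L := GRing.isLinear.Build F A _ *:%R iota iotaL.
pose f : {linear A -> (int -> R)} := HB.pack iota L.
have iotaZ c z j : iota (c *: z) j = c *: iota z j.
  by rewrite -[iota]/(f : _ -> _) linearZ.
have [N hN] := iota_loc y x.
rewrite -[LHS]/(f ((x : A) *[n] (y : A) - cprod_opp n (x : A) (y : A)) k).
rewrite linearB /= -[LHS]/(iota _ k - iota _ k) iotaM iter_zdiffB.
congr (_ - _).
have [N1 hN1] := cprod_local (y : A) (x : A).
have hM : vanish_from (maxn N N1) (fpair mul (iota y) (iota x)).
  by move=> m i j hm; apply: hN; lia.
have hA j : (maxn N N1 <= j)%N -> (y : A) *[j] (x : A) = 0.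
  by move=> hj; apply: hN1; lia.
rewrite -[RHS](fopp_expand (natF_neq0 pcharF) n k hM).
rewrite (cprod_oppE n hA) -[iota]/(f : _ -> _) linear_sum /= fct_sumE.
apply: eq_bigr => s _; rewrite iotaZ /cderiv_div; congr (_ *: _).
rewrite iotaZ; congr (_ *: _).
rewrite -iotaM; elim: s (_ *[_] _) k => //= s IH z k.
by rewrite iotaD /fderiv IH.
Qed.
End FieldMinus.

(** * The Lie algebra of modes *)
Section LieModes.
Variables (F : fieldType) (pcharF : [pchar F] =i pred0).
Variables (L : lieConformalAlgType F) (W : lmodType F).
Notation mode := (L * int)%type.
Notation zdiff := (@zdiff F W).
Implicit Types (a b c : L) (f : mode -> W).
Let nF := natF_neq0 pcharF.

(** Linear functionals on the coefficient Lie algebra, in which the modes of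
    [cderiv a] are multiples of modes of [a]. *)
Definition mode_functional f :=
  (forall k a b n, f (k *: a + b, n) = k *: f (a, n) + f (b, n)) /\
  (forall a n, f (cderiv a, n) = - (n%:~R *: f (a, n - 1))).

(** Some bound is chosen for each pair, to make the bracket of two modes a
    finite formal combination. *)
Definition locbound a b : nat := projT1 (cid (cprod_local a b)).

Lemma locboundP a b n : (locbound a b <= n)%N -> a *[n] b = 0.
Proof. by rewrite /locbound; case: cid => N hN; apply: hN. Qed.

Definition mode_br (x y : mode) : seq (F * mode) :=
  [seq (binz F x.2 t, (x.1 *[t] y.1, x.2 + y.2 - t%:Z)) | t <- iota 0 (locbound x.1
    y.1)].

Notation brlin := (brlin mode_br).

Lemma mode_functional0 : mode_functional (fun=> 0).
Proof. by split=> *; rewrite !scaler0 ?oppr0 ?addr0. Qed.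

Lemma mode_functionalP k f g : mode_functional f -> mode_functional g ->
  mode_functional (fun z => k *: f z + g z).
Proof.
move=> [f1 f2] [g1 g2]; split=> *.
  by rewrite f1 g1 !scalerDr !scalerA mulrC addrACA.
by rewrite f2 g2 scalerDr opprD scalerN !scalerA mulrC.
Qed.

Lemma functional0 f n : mode_functional f -> f (0, n) = 0.
Proof.
by move=> [h _]; apply: (@linear_at0 _ _ _ (fun a => f (a, n))) => k a b; exact: h.
Qed.

Lemma functionalZ f k a n : mode_functional f -> f (k *: a, n) = k *: f (a, n).
Proof. by move=> hf; rewrite -[_ *: a]addr0 hf.1 (functional0 n hf) addr0. Qed.

Lemma functionalN f a n : mode_functional f -> f (- a, n) = - f (a, n).
Proof. by move=> hf; rewrite -(scaleN1r a) functionalZ // scaleN1r. Qed.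

Lemma functionalD f a b n : mode_functional f -> f (a + b, n) = f (a, n) + f (b, n).
Proof. by move=> hf; have := hf.1 1 a b n; rewrite !scale1r. Qed.

Lemma functional_sum f I (r : seq I) (G : I -> L) n : mode_functional f ->
  f (\sum_(i <- r) G i, n) = \sum_(i <- r) f (G i, n).
Proof.
move=> hf; elim: r => [|i r IH]; first by rewrite !big_nil functional0.
by rewrite !big_cons functionalD // IH.
Qed.

Lemma functional_cderiv_div f a n s : mode_functional f ->
  f (cderiv_div s a, n) = ((-1) ^+ s * binz F n s) *: f (a, n - s%:Z).
Proof.
move=> hf; rewrite /cderiv_div functionalZ //.
rewrite -(iter_fderiv nF s (fun n => f (a, n))); congr (_ *: _).
by elim: s n => //= s IH n; rewrite hf.2 IH.
Qed.

(** The value does not depend on the chosen bound, and depends on the two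
    indices as a sum of derivatives of the delta function. *)
Lemma brlinE f x y B : mode_functional f -> (locbound x.1 y.1 <= B)%N ->
  brlin f x y = delta_sum (fun t k => f (x.1 *[t] y.1, k)) B x.2 y.2.
Proof.
move=> hf hB; rewrite /brlin big_map /delta_sum -{1}[locbound _ _]subn0
  -/(index_iota _ _).
rewrite [RHS](big_cat_nat (n:=locbound x.1 y.1)) //= [X in _ =
  _ + X]big_nat_cond [X in _ = _ + X]big1 ?addr0 //.
move=> t /andP[/andP[ht _] _].
by rewrite locboundP // functional0 // scaler0.
Qed.

Lemma mode_vanish f a b B : mode_functional f -> (locbound a b <= B)%N ->
  forall t, (B <= t)%N -> forall k, f (a *[t] b, k) = 0.
Proof. by move=> hf hB t ht k; rewrite locboundP ?functional0 //; lia. Qed.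

Lemma brlin_coef f a b n k : mode_functional f ->
  iter n zdiff (fun i j => brlin f (a, i) (b, j)) 0 k = f (a *[n] b, k).
Proof.
move=> hf; rewrite -(@delta_sum_coef _ _ nF n (fun t k =>
  f (a *[t] b, k)) (locbound a b)).
  by apply: eq_iter_zdiff => i j; rewrite (@brlinE f (a, i) (b, j) (locbound a b)).
exact: mode_vanish.
Qed.

Lemma brlin_vanish f a b N : mode_functional f -> (locbound a b <= N)%N ->
  vanish_from N (fun i j => brlin f (a, i) (b, j)).
Proof.
move=> hf hN n i j hn.
rewrite -(@vanish_delta_sum _ _ nF (fun t k =>
  f (a *[t] b, k)) N (mode_vanish hf hN) n i j hn).
by apply: eq_iter_zdiff => {}i {}j; rewrite (@brlinE f (a, i) (b, j) N).
Qed.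

(** Both sides are local in the two indices, and comparing residues leads to
    the skew-symmetry axiom of a Lie conformal algebra. *)
Lemma brlin_anticomm f x y : mode_functional f -> brlin f x y = - brlin f y x.
Proof.
case: x y => [a i] [b j] hf; apply/eqP; rewrite -subr_eq0 opprK; apply/eqP.
pose N := maxn (locbound a b) (locbound b a).
apply: (@local_uniq _ _ (fun i j => brlin f (a, i) (b, j) + brlin f (b, j) (a, i)) N).
  move=> n {}i {}j hn; rewrite iter_zdiffD (@brlin_vanish f a b N) ?leq_maxl // add0r.
  rewrite (iter_zdiff_swap n (fun i j => brlin f (b, i) (a, j))).
  by rewrite (@brlin_vanish f b a N) ?leq_maxr // scaler0.
move=> n k; rewrite iter_zdiffD brlin_coef //.
rewrite (iter_zdiff_swap n (fun i j => brlin f (b, i) (a, j))).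
have -> : iter n zdiff (fun i j => brlin f (b, i) (a, j)) k 0 =
    \sum_(0 <= s < locbound b a) binz F k s *: f (b *[s + n] a, k - s%:Z).
  have := @iter_zdiff_delta_sum _ _ nF n (fun t k => f (b *[t] a, k)) _ k 0
    (mode_vanish hf (leqnn (locbound b a))).
  rewrite [X in _ = X]/delta_sum addr0 => <-.
  by apply: eq_iter_zdiff => {}i {}j; rewrite (@brlinE f (b, i) (a, j) (locbound b a)).
rewrite cbracketC functionalN // (@cprod_oppE _ _ n a b (locbound b a));
  last exact: locboundP.
rewrite functional_sum // -sumrN scaler_sumr -big_split big1 //= => s _.
rewrite functionalZ // functional_cderiv_div // !scalerA (addnC s n) exprD.
by rewrite mulrA -(mulrA (_ ^+ n)) -expr2 sqrr_sign mulr1 addNr.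
Qed.

Lemma mode_functional_brlinl f y : mode_functional f ->
  mode_functional (fun x => brlin f x y).
Proof.
case: y => [c m] hf; split=> [k a b n|a n].
  pose B := maxn (locbound (k *: a + b) c) (maxn (locbound a c) (locbound b c)).
  rewrite !(@brlinE f _ _ B) /= ?leq_max ?leqnn ?orbT //; [|lia..].
  rewrite /delta_sum scaler_sumr -big_split; apply: eq_bigr => t _ /=.
  by rewrite cprod_linearl hf.1 scalerDr !scalerA mulrC.
pose B := (maxn (locbound (cderiv a) c) (locbound a c)).
rewrite (@brlinE f (cderiv a, n) (c, m) B.+1) /= //; last by lia.
rewrite (@brlinE f (a, n - 1) (c, m) B) /= //; last by lia.
rewrite /delta_sum big_nat_recl // cprod_cderivl mulr0n oppr0 functional0 //
  scaler0 add0r.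
rewrite scaler_sumr -sumrN; apply: eq_bigr => t _.
rewrite cprod_cderivl functionalN // -scaler_nat functionalZ // scalerN !scalerA.
rewrite mulrC binz_absorb //; congr (- (_ *: f (_, _))); lia.
Qed.

Lemma mode_functional_brlinr f x : mode_functional f ->
  mode_functional (fun y => brlin f x y).
Proof.
move=> hf; have := mode_functionalP (-1) (mode_functional_brlinl x hf) mode_functional0.
congr mode_functional; apply/funext => y.
by rewrite addr0 scaleN1r -brlin_anticomm.
Qed.

(** A functional evaluated on [[a_i, [b_j, c_k]]]. *)
Definition nest f a b c : int -> int -> int -> W :=
  fun i j k => brlin (fun z => brlin f (a, i) z) (b, j) (c, k).

Lemma nest_coef f a b c p q k : mode_functional f ->
  iter p (@d13 F W) (iter q (@d23 F W) (nest f a b c)) 0 0 k =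
  f (a *[p] (b *[q] c), k).
Proof.
move=> hf; rewrite iter_d13 -(brlin_coef a (b *[q] c) p k hf).
apply: eq_iter_zdiff => i {}k; rewrite iter_d23.
exact: (brlin_coef b c q k (mode_functional_brlinr (a, i) hf)).
Qed.

(** Only finitely many of the products of [b] and [c] are nonzero, hence one
    bound serves for [a] and all of them. *)
Lemma nest_vanish f a b c : mode_functional f -> exists N, forall p, (N <= p)%N ->
  forall i j k, iter p (@d13 F W) (nest f a b c) i j k = 0 /\
                iter p (@d23 F W) (nest f a b c) i j k = 0.
Proof.
move=> hf; pose M := \max_(t < locbound b c) locbound a (b *[t] c).
exists (maxn M (locbound b c)) => p hp i j k; split; last first.
  rewrite iter_d23 (brlin_vanish (mode_functional_brlinr (a, i) hf) (leqnn
    (locbound b c))) //; lia.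
rewrite iter_d13.
pose G t i k := brlin f (a, i) (b *[t] c, k).
have nestE i' k' : nest f a b c i' j k' =
    \sum_(t < locbound b c) binz F j t *: G t i' (j + k' - t%:Z).
  rewrite /nest (@brlinE _ (b, j) (c, k') (locbound b c)) //=;
    last exact: mode_functional_brlinr.
  by rewrite /delta_sum big_mkord.
rewrite (eq_iter_zdiff p nestE).
have -> : iter p zdiff (fun i k => \sum_(t < locbound b c)
      binz F j t *: G t i (j + k - t%:Z)) i k =
    \sum_(t < locbound b c) binz F j t *: iter p zdiff (G t) i (j + k - t%:Z).
  elim: p {hp} i k => //= p IH i k; rewrite /zdiff !IH -sumrB.
  apply: eq_bigr => t _; rewrite -scalerBr.
  by rewrite (addrA j k 1) (addrAC (j + k) 1).
rewrite big1 // => t _; rewrite (@brlin_vanish f a (b *[t] c) M) ?scaler0 //.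
  by rewrite /M; apply: (@leq_bigmax _ (fun t : 'I_(locbound b c) =>
    locbound a (b *[t] c))).
by apply: leq_trans hp; rewrite leq_maxl.
Qed.

(** [(z_1 - z_2)^(N + N)] lies in the ideal generated by [(z_1 - z_3)^N] and
    [(z_2 - z_3)^N]. *)
Lemma d12_vanish (Y : int -> int -> int -> W) N :
  (forall p, (N <= p)%N -> forall i j k,
     iter p (@d13 F W) Y i j k = 0 /\ iter p (@d23 F W) Y i j k = 0) ->
  forall p i j k, (N + N <= p)%N -> iter p (@d12 F W) Y i j k = 0.
Proof.
move=> h p i j k hp.
have z13 r i' j' k' : iter r (@d13 F W) 0 i' j' k' = 0 by rewrite iter_d13 iter_zdiff0.
have z23 r i' j' k' : iter r (@d23 F W) 0 i' j' k' = 0 by rewrite iter_d23 iter_zdiff0.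
have := iter_d2312_at 0 p Y i j k; rewrite /= => ->; rewrite big1 // => s _.
have [hs|hs] := leqP N s.
  have -> : iter s (@d23 F W) Y = 0 by apply: fun3P => *; rewrite (h _ hs _ _ _).2.
  by rewrite z13 scaler0.
have hs' : (N <= p - s)%N by lia.
rewrite iter_d1323.
have -> : iter (p - s) (@d13 F W) Y = 0.
  by apply: fun3P => *; rewrite (h _ hs' _ _ _).1.
by rewrite z23 scaler0.
Qed.

Lemma iter_sub (U : zmodType) (P : U -> U) n x y :
  (forall x y, P (x - y) = P x - P y) -> iter n P (x - y) = iter n P x - iter n P y.
Proof. by move=> h; elim: n => //= n ->. Qed.

Lemma d12B (Y Z : int -> int -> int -> W) : d12 (Y - Z) = d12 Y - d12 Z.
Proof.
apply: fun3P => i j k; rewrite /d12 !fctE /= !opprD !opprK.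
by rewrite [LHS](AC (2*2) ((1*3)*(2*4))).
Qed.

Lemma d23B (Y Z : int -> int -> int -> W) : d23 (Y - Z) = d23 Y - d23 Z.
Proof.
apply: fun3P => i j k; rewrite /d23 !fctE /= !opprD !opprK.
by rewrite [LHS](AC (2*2) ((1*3)*(2*4))).
Qed.

Lemma iter_d13_swap n (Y : int -> int -> int -> W) :
  iter n (@d13 F W) (fun i j k => Y j i k) = fun i j k => iter n (@d23 F W) Y j i k.
Proof. by elim: n => //= n ->; apply: fun3P. Qed.

Lemma iter_d23_swap n (Y : int -> int -> int -> W) :
  iter n (@d23 F W) (fun i j k => Y j i k) = fun i j k => iter n (@d13 F W) Y j i k.
Proof. by elim: n => //= n ->; apply: fun3P. Qed.

(** Uniqueness of local distributions is applied first in [z_1] and [z_2],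
    then in [z_2] and [z_3].  This leaves the residues against
    [(z_1 - z_2)^m (z_2 - z_3)^n], where the expansion in powers of
    [z_1 - z_3] and [z_2 - z_3] produces the Jacobi identity of the conformal
    algebra. *)
Lemma brlin_jacobi f x y z : mode_functional f ->
  brlin (fun t => brlin f t y) x z + brlin (fun t => brlin f x t) y z =
  brlin (fun t => brlin f t z) x y.
Proof.
case: x y z => [a i] [b j] [c k] hf.
have -> : brlin (fun t => brlin f t (b, j)) (a, i) (c, k) = - nest f b a c j i k.
  rewrite /nest /brlin -sumrN; apply: eq_bigr => p _.
  by rewrite -scalerN -brlin_anticomm.
pose T1 : int -> int -> int -> W :=
  fun i j k => brlin (fun t => brlin f t (c, k)) (a, i) (b, j).
pose T2 := nest f a b c.
pose T3 : int -> int -> int -> W := fun i j k => nest f b a c j i k.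
have T1c m j' k' : iter m (@d12 F W) T1 0 j' k' = brlin f (a *[m] b, j') (c, k').
  by rewrite iter_d12 /T1 brlin_coef //; apply: mode_functional_brlinl.
have [N2 hN2] := nest_vanish a b c hf; have [N3 hN3] := nest_vanish b a c hf.
have hN3' p : (N3 <= p)%N -> forall i j k,
    iter p (@d13 F W) T3 i j k = 0 /\ iter p (@d23 F W) T3 i j k = 0.
  move=> hp i' j' k'; rewrite /T3 (iter_d13_swap p (nest f b a c)).
  by rewrite (iter_d23_swap p (nest f b a c)); have [h1 h2] := hN3 p hp j' i' k'; split.
suff key i' j' k' : T1 i' j' k' - (T2 i' j' k' - T3 i' j' k') = 0.
  by move/eqP: (key i j k); rewrite subr_eq0 -/(T1 i j k) => /eqP ->; rewrite addrC.
pose Z := T1 - (T2 - T3); rewrite -[LHS]/(Z i' j' k').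
have ZE m : iter m (@d12 F W) Z = iter m (@d12 F W) T1 -
    (iter m (@d12 F W) T2 - iter m (@d12 F W) T3).
  by rewrite !(iter_sub _ _ _ d12B).
have ZE2 n m : iter n (@d23 F W) (iter m (@d12 F W) Z) =
    iter n (@d23 F W) (iter m (@d12 F W) T1) -
    (iter n (@d23 F W) (iter m (@d12 F W) T2) -
     iter n (@d23 F W) (iter m (@d12 F W) T3)).
  by rewrite ZE !(iter_sub _ _ _ d23B).
pose N1 := maxn (locbound a b) (maxn (N2 + N2) (N3 + N3)).
apply: (@local_uniq _ _ (fun i j => Z i j k') N1) => [n {}i' {}j' hn|m {}j'].
  rewrite -iter_d12 ZE !fctE /=.
  rewrite (d12_vanish hN2) ?(d12_vanish hN3') ?subrr ?subr0; [|lia..].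
  rewrite iter_d12 (brlin_vanish (mode_functional_brlinl (c, k') hf) (leqnn _)) //; lia.
rewrite -(iter_d12 m Z).
pose M := maxn (locbound (a *[m] b) c) (maxn N2 N3).
have comm n Y : iter n (@d23 F W) (iter m (@d12 F W) Y) =
  iter m (@d12 F W) (iter n (@d23 F W) Y).
  have h V : iter n (@d23 F W) (d12 V) = d12 (iter n (@d23 F W) V).
    elim: n => //= n ->; apply: fun3P => *; rewrite /d12 /d23 !opprB.
    by rewrite [LHS](AC (2*2) ((1*4)*(3*2))) .
  by elim: m {T1c ZE ZE2 M} => //= m <-; rewrite h.
have z12 r i'' j'' k'' : iter r (@d12 F W) 0 i'' j'' k'' =
  0 by rewrite iter_d12 iter_zdiff0.
apply: (@local_uniq _ _ (fun j k => iter m (@d12 F W) Z 0 j k) M) =>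
  [n {}j' {}k' hn|n {}k'].
  rewrite -[LHS](iter_d23 n (iter m (@d12 F W) Z) 0) ZE2 !fctE /=.
  rewrite !(comm n T2) !(comm n T3).
  have -> : iter n (@d23 F W) T2 = 0.
    by apply: fun3P => *; rewrite (hN2 n _ _ _ _).2 //; lia.
  have -> : iter n (@d23 F W) T3 = 0.
    by apply: fun3P => *; rewrite (hN3' n _ _ _ _).2 //; lia.
  rewrite z12 !subr0 iter_d23 (eq_iter_zdiff n (T1c m)).
  by rewrite (brlin_vanish hf (leqnn _)) //; lia.
rewrite -[LHS](iter_d23 n (iter m (@d12 F W) Z) 0) ZE2 !fctE /=.
rewrite iter_d23 (eq_iter_zdiff n (T1c m)) brlin_coef // cbracketJ functional_sum //.
rewrite !iter_d2312_at -!sumrB big1 // => s _.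
rewrite functionalZ // -!scalerBr nest_coef // iter_d23_swap iter_d13_swap -iter_d1323.
by rewrite nest_coef // functionalD // functionalN // subrr scaler0.
Qed.

End LieModes.

(** * Difference operators in labelled variables *)
Section Valuations.
Variables (F : fieldType) (W : lmodType F).
Notation val_ := (nat -> int).
Notation vfun := (val_ -> W).
Implicit Types (nu : val_) (h : vfun) (d : seq (nat * nat)) (S : seq nat) (k : int).

(** A distribution in several variables is a function of a valuation, which
    gives to every label the index at the variable of that label.  With labels
    instead of positions, permuting the variables needs no bookkeeping. *)
Definition shiftv nu a : val_ := fun c => nu c + (c == a)%:Z.
Definition upd nu a v : val_ := fun c => if c == a then v else nu c.

(** Multiplication by [z_a - z_b]. *)
Definition ldiff (p : nat * nat) h : vfun :=
  fun nu => h (shiftv nu p.1) - h (shiftv nu p.2).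
Fixpoint ldiffs d h : vfun := if d is p :: d' then ldiffs d' (ldiff p h) else h.

Lemma shiftvC nu a b : shiftv (shiftv nu a) b = shiftv (shiftv nu b) a.
Proof. by apply/funext => c; rewrite /shiftv addrAC. Qed.

Lemma eq_ldiffs d h1 h2 : (forall nu, h1 nu = h2 nu) ->
  forall nu, ldiffs d h1 nu = ldiffs d h2 nu.
Proof. by move=> e; have -> : h1 = h2 by apply/funext. Qed.

Lemma ldiffsP d c h1 h2 nu :
  ldiffs d (fun nu => c *: h1 nu + h2 nu) nu = c *: ldiffs d h1 nu + ldiffs d h2 nu.
Proof.
elim: d h1 h2 => //= p d IH h1 h2; rewrite -IH; apply: eq_ldiffs => nu1.
by rewrite /ldiff scalerBr opprD addrACA.
Qed.

Lemma ldiffs0 d nu : ldiffs d (fun=> 0) nu = 0.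
Proof.
elim: d => //= p d IH; rewrite -[RHS]IH; apply: eq_ldiffs => nu1.
by rewrite /ldiff subrr.
Qed.

Lemma ldiffs_comp d h e nu :
  (forall p, p \in d -> forall nu, e (shiftv nu p.1) = shiftv (e nu) p.1 /\
                                   e (shiftv nu p.2) = shiftv (e nu) p.2) ->
  ldiffs d (fun nu => h (e nu)) nu = ldiffs d h (e nu).
Proof.
elim: d h => //= p d IH h he; rewrite -IH; last first.
  by move=> q qd; apply: he; rewrite inE qd orbT.
apply: eq_ldiffs => nu1; rewrite /ldiff.
by have [-> ->] := he p (mem_head _ _) nu1.
Qed.

Definition labels_in S d := all (fun p => (p.1 \in S) && (p.2 \in S)) d.

(** Multiplying by differences of variables labelled in [S] leaves the indices
    at all other variables alone. *)
Lemma ldiffs_local d S h1 h2 nu : labels_in S d ->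
  (forall nu', (forall c, c \notin S -> nu' c = nu c) -> h1 nu' = h2 nu') ->
  ldiffs d h1 nu = ldiffs d h2 nu.
Proof.
elim: d h1 h2 => [|p d IH] h1 h2 /=; first by move=> _ ->.
move=> /andP[/andP[p1 p2] hd] e; apply: IH => // nu' hn.
rewrite /ldiff !e // => c hc; rewrite /shiftv hn //;
  by case: eqP => [ec|_]; rewrite ?addr0 //; move: hc; rewrite ec ?p1 ?p2.
Qed.

(** Every product of at least [k] differences of variables labelled in [S]
    annihilates [h].  The products of [k] differences span the translation
    invariant homogeneous polynomials of degree [k].  In a single variable
    every difference is 0, so there the condition is empty once [k > 0]. *)
Definition diff_null S k h := forall d, labels_in S d -> (k <= (size d)%:Z)%R ->
  forall nu, ldiffs d h nu = 0.

Lemma diff_null0 S k : diff_null S k (fun=> 0).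
Proof. by move=> d _ _ nu; apply: ldiffs0. Qed.

Lemma diff_nullP S k c h1 h2 : diff_null S k h1 -> diff_null S k h2 ->
  diff_null S k (fun nu => c *: h1 nu + h2 nu).
Proof. by move=> n1 n2 d hd hk nu; rewrite ldiffsP n1 // n2 // scaler0 addr0. Qed.

Lemma diff_nullD S k h1 h2 : diff_null S k h1 -> diff_null S k h2 ->
  diff_null S k (fun nu => h1 nu + h2 nu).
Proof.
move=> n1 n2; have := diff_nullP 1 n1 n2; congr diff_null; apply/funext => nu.
by rewrite scale1r.
Qed.

Lemma diff_nullZ S k c h : diff_null S k h -> diff_null S k (fun nu => c *: h nu).
Proof.
move=> n1; have := diff_nullP c n1 (@diff_null0 S k); congr diff_null;
  apply/funext => nu.
by rewrite addr0.
Qed.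

Lemma diff_null_sub S S' k h : {subset S' <= S} -> diff_null S k h -> diff_null S' k h.
Proof.
move=> sS hN d hd; apply: hN; apply: sub_all hd => p /andP[p1 p2].
by rewrite !sS.
Qed.

Lemma diff_null_le S k k' h : (k <= k')%R -> diff_null S k h -> diff_null S k' h.
Proof. by move=> hk hN d hd hd'; apply: hN => //; lia. Qed.

Lemma diff_null_ldiff S k h p : p.1 \in S -> p.2 \in S -> diff_null S k h ->
  diff_null S (k - 1) (ldiff p h).
Proof.
move=> p1 p2 hN d hd hk nu; apply: (hN (p :: d)); first by rewrite /= p1 p2.
by rewrite /=; lia.
Qed.

Lemma diff_null_sum_splits (X : Type) S k (G : val_ -> seq X -> X -> seq X -> W) w :
  (forall a m b, w = a ++ m :: b -> diff_null S k (fun nu => G nu a m b)) ->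
  diff_null S k (fun nu => sum_splits (G nu) w).
Proof.
elim: w G => [|x w IH] G h /=; first exact: diff_null0.
apply: diff_nullD; first exact: h.
by apply: (IH (fun nu a m b => G nu (x :: a) m b)) => a m b e; apply: h; rewrite e.
Qed.

Hypothesis nF : forall n, (n.+1%:R : F) != 0.

(** The shape in which a bracket of [u_i(z_i)] and [u_j(z_j)] occurs, [g t]
    being the contribution of the product with index [t]: a sum of
    [g_t delta^(t)(z_i - z_j) / t!], in which the variable labelled [i]
    remains. *)
Definition contraction i j (g : nat -> vfun) B : vfun := fun nu =>
  \sum_(0 <= t < B) binz F (nu i) t *: g t (upd nu i (nu i + nu j - t%:Z)).

(** Multiplying a contraction by [z_j] is the same as multiplying by [z_i]
    inside; multiplying it by [z_i] leaves in addition the terms in which the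
    delta functions have lost one derivative. *)
Lemma contraction_shift i j (g : nat -> vfun) B c nu : i != j ->
  (forall t nu, g t (shiftv nu j) = g t nu) ->
  (forall t nu, (B <= t)%N -> g t nu = 0) ->
  contraction i j g B (shiftv nu c) =
  contraction i j (fun t nu => (c == i)%:R *: g t.+1 nu +
               g t (shiftv nu (if c == j then i else c))) B nu.
Proof.
move=> ij gj gB; rewrite /contraction /shiftv [i == c]eq_sym.
have [->|ci] := eqVneq c i; last first.
  apply: eq_bigr => t _; rewrite scale0r add0r addr0.
  congr (_ *: _); have [->|cj] := eqVneq c j.
    rewrite -[in RHS]gj; congr (g t _); apply/funext => x.
    rewrite /upd /shiftv; case: (eqVneq x i) => [->|xi].
      by rewrite (negPf ij) addr0; lia.
    by rewrite addr0.
  congr (g t _); apply/funext => x.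
  rewrite /upd /shiftv; case: (eqVneq x i) => [->|xi //].
  by rewrite [i == c]eq_sym (negPf ci); lia.
rewrite (negPf ij) [j == i]eq_sym (negPf ij).
under [RHS]eq_bigr do rewrite scale1r scalerDr.
rewrite [RHS]big_split /=.
have E t : upd (fun c => nu c + (c == i)%:Z) i (nu i + true%:Z + (nu j + false%:Z)
  - t%:Z) =
    shiftv (upd nu i (nu i + nu j - t%:Z)) i.
  by apply/funext => x; rewrite /upd /shiftv; case: (eqVneq x i) => [_|]; lia.
under [LHS]eq_bigr do rewrite E.
case: B gB => [|B] gB; first by rewrite !big_geq ?addr0.
rewrite big_nat_recl // [X in _ = _ + X]big_nat_recl // !binz0.
rewrite [X in _ = X + _]big_nat_recr //= (gB B.+1) // scaler0 !addr0.
rewrite [RHS]addrCA; congr (_ + _); rewrite -big_split; apply: eq_bigr => t _ /=.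
rewrite binzS // scalerDl addrC.
have -> // : upd nu i (nu i + nu j - t%:Z) =
  shiftv (upd nu i (nu i + nu j - t.+1%:Z)) i.
by apply/funext => x; rewrite /upd /shiftv; case: (eqVneq x i) => [_|]; lia.
Qed.

(** A product of [k] differences meets [delta^(t)]; at most [t] of them are
    used up to lower the order of the derivative, hence at least [k - t] of
    them reach [g t].  The induction replaces the family [g] by the family
    which is contracted after one multiplication. *)
Lemma diff_null_contraction S S' i j (g : nat -> vfun) B k : i != j -> i \in S' ->
  (forall c, c \in S -> c != j -> c \in S') ->
  (forall t nu, g t (shiftv nu j) = g t nu) ->
  (forall t nu, (B <= t)%N -> g t nu = 0) ->
  (forall t, diff_null S' (k - t%:Z) (g t)) ->
  diff_null S k (contraction i j g B).
Proof.
move=> ij iS' SS' gj gB gN d; elim: d k g gj gB gN => [|p d IH] k g gj gB gN /=.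
  move=> _ hk nu; rewrite /contraction big1 // => t _.
  have g0 nu1 : g t nu1 = 0 by apply: (gN t [::]) => //=; lia.
  by rewrite g0 scaler0.
move=> /andP[/andP[p1 p2] hd] hk nu.
pose r c := if c == j then i else c.
have rS c : c \in S -> r c \in S'.
  by rewrite /r; case: eqVneq => // cj cS; apply: SS'.
pose g' t nu := ldiff (r p.1, r p.2) (g t) nu +
  ((p.1 == i)%:R - (p.2 == i)%:R : F) *: g t.+1 nu.
rewrite -[RHS](IH (k - 1) g' _ _ _ hd _ nu).
- apply: eq_ldiffs => {}nu; rewrite {1}/ldiff !contraction_shift // /contraction -sumrB.
  apply: eq_bigr => t _; rewrite -scalerBr; congr (_ *: _).
  rewrite /g' /ldiff scalerBl /= opprD addrACA addrC; congr (_ + _).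
- by move=> t {}nu; rewrite /g' /ldiff /= !(shiftvC _ j) !gj.
- by move=> t {}nu ht; rewrite /g' /ldiff !gB ?scaler0 ?subrr ?addr0 //; lia.
- move=> t; apply: diff_nullD.
    have := diff_null_ldiff (p := (r p.1, r p.2)) (rS _ p1) (rS _ p2) (gN t).
    by apply: diff_null_le; lia.
  by apply: diff_nullZ; apply: diff_null_le (gN t.+1); lia.
- lia.
Qed.

End Valuations.

Lemma sum_splits_map (X Y : Type) (W : zmodType) (g : X -> Y)
    (H : seq Y -> Y -> seq Y -> W) w :
  sum_splits H (map g w) = sum_splits (fun a m b => H (map g a) (g m) (map g b)) w.
Proof. by elim: w H => //= x w IH H; rewrite IH. Qed.

(** * Words of bounded weight *)
Section Dspan.
Variables (F : fieldType) (V : lmodType F) (D : V -> V) (pr : nat -> V -> V -> V).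
Variable T : V -> Prop.
Hypothesis prl : forall n b, linear (fun a => pr n a b).
Hypothesis prr : forall n a, linear (pr n a).
Hypothesis prD : forall n a b, D (pr n a b) = pr n (D a) b + pr n a (D b).
Hypothesis prDl : forall n a b, pr n (D a) b = - (pr n.-1 a b *+ n).

(** The span of all derivatives of the elements of [T]. *)
Inductive dspan : V -> Prop :=
| dspan_base x : T x -> dspan x
| dspan0 : dspan 0
| dspan_lin k x y : dspan x -> dspan y -> dspan (k *: x + y)
| dspan_D x : dspan x -> dspan (D x).

Lemma dspanB x y : dspan x -> dspan y -> dspan (x - y).
Proof. by move=> hx hy; rewrite addrC -scaleN1r; apply: dspan_lin. Qed.

Lemma dspanMn x n : dspan x -> dspan (x *+ n).
Proof.
move=> hx; rewrite -scaler_nat -[_ *: _]addr0.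
by apply: dspan_lin => //; apply: dspan0.
Qed.

Lemma dspanN x : dspan x -> dspan (- x).
Proof. by move=> hx; rewrite -sub0r; apply: dspanB => //; apply: dspan0. Qed.

(** By the Leibniz rule, derivatives can be moved out of products. *)
Lemma dspan_pr n x y : (forall n x y, T x -> T y -> T (pr n x y)) ->
  dspan x -> dspan y -> dspan (pr n x y).
Proof.
move=> hT hx hy; elim: hx n => {x} [x Tx||k x z hx IHx hz IHz|x hx IH] n.
- elim: hy n => {y} [y Ty||k y z hy IHy hz IHz|y hy IH] n.
  + exact/dspan_base/hT.
  + by rewrite (linear_at0 (prr n x)); apply: dspan0.
  + by rewrite prr; apply: dspan_lin.
  + have /(canRL (addKr _)) -> := esym (prD n x y).
    rewrite addrC; apply: dspanB; first exact: dspan_D.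
    by rewrite prDl; apply/dspanN/dspanMn.
- by rewrite (linear_at0 (prl n y)); apply: dspan0.
- by rewrite prl; apply: dspan_lin.
- by rewrite prDl; apply/dspanN/dspanMn.
Qed.

End Dspan.

Section Bounded.
Variables (F : fieldType) (pcharF : [pchar F] =i pred0).
Variables (L : lieConformalAlgType F) (G : set L) (K : int).
Hypothesis Ggen : conformal_generates G.
Hypothesis GK : forall l : nat, (1 <= l)%N -> locality_le G l K.
Notation mode := (L * int)%type.
Let nF := natF_neq0 pcharF.

Definition is_word (u : L) := exists l m, conformal_word G l m u.

Lemma conformal_word_gt0 l m (u : L) : conformal_word G l m u -> (0 < l)%N.
Proof. by elim=> // *; rewrite addn_gt0; apply/orP; left. Qed.

Lemma dspan_word (a : L) : dspan (@cderiv F L) is_word a.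
Proof.
have : [set: L]%classic a by [].
rewrite -Ggen; apply; split; last first.
  by move=> g Gg; apply: dspan_base; exists 1%N, 0%N; apply: conformal_word_gen.
split; first exact: dspan0.
- by move=> k x y; apply: dspan_lin.
- by move=> x; apply: dspan_D.
- move=> n x y; apply: dspan_pr.
  + exact: cprod_linearl.
  + exact: cprod_linearr.
  + exact: cderiv_cprod.
  + exact: cprod_cderivl.
  + move=> {}n {}x {}y [l1 [m1 w1]] [l2 [m2 w2]].
    by exists (l1 + l2)%N, (m1 + m2 + n)%N; apply: conformal_word_mul.
Qed.

(** The action of modes on the vacuum: [a(-1-n)] gives [D^(n) a], and the
    modes with nonnegative index give 0. *)
Definition on_vacuum (x : mode) : L :=
  match x.2 with Posz _ => 0 | Negz n => cderiv_div n x.1 end.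

Lemma mode_functional_vacuum : mode_functional on_vacuum.
Proof.
split=> [k a b [n|n]|a [n|n]]; rewrite /on_vacuum /=.
- by rewrite scaler0 addr0.
- by rewrite linearP.
- case: n => [|n]; first by rewrite scale0r oppr0.
  by rewrite (_ : n.+1%:Z - 1 = n%:Z) ?scaler0 ?oppr0 //; lia.
- rewrite cderiv_divS // ?addn0.
  by rewrite -scaler_nat -scaleNr; congr (_ *: _); rewrite NegzE rmorphN opprK.
Qed.

Definition lie_proj := pbw_proj (@mode_br F L) on_vacuum.

Lemma lie_proj_slotwise : slotwise (@mode_functional F L L) lie_proj.
Proof.
apply: slotwise_pbw_proj.
- exact: mode_functional0.
- exact: mode_functionalP.
- by move=> f y; apply: mode_functional_brlinl.
- by move=> f x; apply: mode_functional_brlinr.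
- exact: mode_functional_vacuum.
Qed.

Lemma lie_proj_swap u x y v :
  lie_proj (u ++ x :: y :: v) - lie_proj (u ++ y :: x :: v) =
  brlin (@mode_br F L) (fun z => lie_proj (u ++ z :: v)) x y.
Proof.
apply: (@pbw_proj_swap F mode L (@mode_br F L) (@mode_functional F L L)).
- exact: mode_functional0.
- exact: mode_functionalP.
- by move=> f y'; apply: mode_functional_brlinl.
- by move=> f x'; apply: mode_functional_brlinr.
- by move=> f x' y'; apply: brlin_anticomm.
- by move=> f x' y' m; apply: brlin_jacobi.
- exact: nF.
- exact: mode_functional_vacuum.
Qed.

Lemma slotwise_pbw_vacuum n : slotwise (@mode_functional F L L) (pbw_level
  (@mode_br F L) on_vacuum n).
Proof.
apply: slotwise_pbw_level.
- exact: mode_functional0.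
- exact: mode_functionalP.
- by move=> f y; apply: mode_functional_brlinl.
- by move=> f x; apply: mode_functional_brlinr.
- exact: mode_functional_vacuum.
Qed.

Notation letter := (nat * (L * nat))%type.
Implicit Types (om : seq letter) (x y m : letter).

(** A letter [(i, (u, m))] is the distribution of [u], a word of weight [m],
    in the variable labelled [i]. *)
Definition mode_of (nu : nat -> int) x : mode := (x.2.1, nu x.1).
Definition modes nu om := map (mode_of nu) om.
Definition labels om := map fst om.
Definition weight om := sumn (map (fun x : letter => x.2.2) om).
Definition weighted_words om := forall x, x \in om ->
  exists l, conformal_word G l x.2.2 x.2.1.

Lemma modes_upd nu i v om : i \notin labels om -> modes (upd nu i v) om = modes nu om.
Proof.
elim: om => //= x om IH; rewrite inE negb_or => /andP[xi hi].
by rewrite /mode_of /upd eq_sym (negPf xi) -/(modes _ _) IH.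
Qed.

Lemma modes_shiftv nu i om : i \notin labels om -> modes (shiftv nu i) om = modes nu om.
Proof.
elim: om => //= x om IH; rewrite inE negb_or => /andP[xi hi].
by rewrite /mode_of /shiftv eq_sym (negPf xi) addr0 -/(modes _ _) IH.
Qed.

(** The bound on the locality for words in the enveloping algebra: degree of
    the polynomial plus weights at least [K] implies 0. *)
Definition level_null n (f : seq mode -> L) := forall om, size om = n ->
  uniq (labels om) -> weighted_words om ->
  diff_null (labels om) (K - (weight om)%:Z) (fun nu => f (modes nu om)).

Lemma weightE om om' : perm_eq om om' -> weight om = weight om'.
Proof. by move=> h; apply/perm_sumn/perm_map. Qed.

(** Each bracket is a contraction whose term with index [t] has a letter of a
    weight greater by [t], and that is the loss in degree permitted by
    [diff_null_contraction]. *)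
Lemma null_crossing f n u a m b : slotwise (@mode_functional F L L) f ->
  level_null n f ->
  size (u ++ a ++ m :: b) = n.+1 -> uniq (labels (u ++ a ++ m :: b)) ->
  weighted_words (u ++ a ++ m :: b) ->
  diff_null (labels (u ++ a ++ m :: b)) (K - (weight (u ++ a ++ m :: b))%:Z)
    (fun nu => crossing (@mode_br F L) f (modes nu u) (modes nu a) (mode_of nu m)
      (modes nu b)).
Proof.
move=> fA fB sn un wo; rewrite /crossing.
under eq_fun do rewrite sum_splits_map.
apply: diff_null_sum_splits => a1 y a2 ea.
pose i := y.1; pose j := m.1.
pose g t := fun nu : nat -> int =>
  f (modes nu (u ++ a1 ++ (i, (y.2.1 *[t] m.2.1, (y.2.2 + m.2.2 + t)%N)) :: a2 ++ b)).
have pe : perm_eq (u ++ a ++ m :: b) (y :: m :: (u ++ a1 ++ a2 ++ b)).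
  by rewrite ea; apply/permP => P; rewrite !count_cat /= !count_cat /=; lia.
have pl : perm_eq (labels (u ++ a ++ m :: b)) (i :: j :: labels (u ++ a1 ++ a2 ++ b)).
  exact: (perm_map fst pe).
move: (un); rewrite (perm_uniq pl) /= inE negb_or => /andP[/andP[ij iN] /andP[jN un']].
have iN4 : [/\ i \notin labels u, i \notin labels a1, i \notin labels a2 & i \notin
  labels b].
  by move: iN; rewrite /labels !map_cat !mem_cat !negb_or => /and4P[].
have -> : (fun nu => brlin (@mode_br F L) (fun z =>
  f (modes nu u ++ map (mode_of nu) a1 ++ z ::
    map (mode_of nu) a2 ++ modes nu b)) (mode_of nu y) (mode_of nu m)) =
    contraction i j g (locbound y.2.1 m.2.1).
  apply/funext => nu.
  have hA : mode_functional (fun z => f (modes nu u ++ map (mode_of nu) a1 ++ z ::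
    map (mode_of nu) a2 ++ modes nu b)).
    have := fA (modes nu u ++ map (mode_of nu) a1) (map (mode_of nu) a2 ++ modes nu b).
    by congr mode_functional; apply/funext => z; rewrite -catA.
  rewrite (@brlinE _ _ _ _ (mode_of nu y) (mode_of nu m) (locbound y.2.1 m.2.1) hA) //.
  apply: eq_bigr => t _; congr (_ *: _); rewrite /g.
  rewrite /modes !map_cat /= map_cat -!/(modes _ _).
  have [h1 h2 h3 h4] := iN4.
  by rewrite !modes_upd // /mode_of /= /upd eqxx.
apply: (diff_null_contraction nF (S' := i :: labels (u ++ a1 ++ a2 ++ b))).
- exact: ij.
- exact: mem_head.
- by move=> c; rewrite (perm_mem pl) !inE => /or3P[->|/eqP ->|->]; rewrite ?eqxx ?orbT.
- move=> t nu; rewrite /g; congr f; apply: modes_shiftv.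
  move: jN ij; rewrite /labels !map_cat !mem_cat /= !inE !negb_or map_cat mem_cat
    negb_or.
  by move=> /and4P[-> -> -> ->]; rewrite eq_sym => ->.
- move=> t nu ht; rewrite /g /modes !map_cat /=.
  rewrite [mode_of nu _]/mode_of /= locboundP //.
  have := functional0 (nu i) (fA (map (mode_of nu) u ++ map (mode_of nu) a1)
    (map (mode_of nu) (a2 ++ b))).
  by rewrite -catA.
move=> t; pose om := u ++ a1 ++ (i, (y.2.1 *[t] m.2.1, (y.2.2 + m.2.2 + t)%N)) ::
  a2 ++ b.
have pom : perm_eq om ((i, (y.2.1 *[t] m.2.1, (y.2.2 + m.2.2 + t)%N)) :: u ++ a1 ++
  a2 ++ b).
  by apply/permP => P; rewrite !count_cat /= !count_cat /=; lia.
have plo : perm_eq (labels om) (i :: labels (u ++ a1 ++ a2 ++ b)) by exact: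
  (perm_map fst pom).
have so : size om = n.
  by move: sn; rewrite (perm_size pom) (perm_size pe) /=; lia.
have := fB om so; rewrite (perm_uniq plo) /= iN un' => /(_ isT) hB.
have -> : K - (weight (u ++ a ++ m :: b))%:Z - t%:Z = K - (weight om)%:Z.
  by rewrite (weightE pe) (weightE pom) /weight /=; lia.
apply: diff_null_sub (hB _); first by move=> c; rewrite (perm_mem plo).
move=> x; rewrite (perm_mem pom) inE => /orP[/eqP ->|hx] /=; last first.
  by apply: wo; rewrite (perm_mem pe) !inE hx !orbT.
have [l1 w1] := wo y ltac:(by rewrite (perm_mem pe) mem_head).
have [l2 w2] := wo m ltac:(by rewrite (perm_mem pe) !inE eqxx orbT).
by exists (l1 + l2)%N; apply: conformal_word_mul.
Qed.

Lemma null_sort_avg f n : slotwise (@mode_functional F L L) f -> level_null n f ->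
  forall k u w, size (u ++ w) = n.+1 -> uniq (labels (u ++ w)) ->
    weighted_words (u ++ w) ->
  diff_null (labels (u ++ w)) (K - (weight (u ++ w))%:Z)
    (fun nu => sort_avg (@mode_br F L) f k (modes nu u) (modes nu w)).
Proof.
move=> fA fB; elim=> [|k IH] u w sn un wo; first exact: diff_null0.
rewrite /=; apply: diff_nullZ; under eq_fun do rewrite sum_splits_map.
apply: diff_null_sum_splits => a m b ew; apply: diff_nullD.
  by rewrite ew; apply: (null_crossing fA fB); rewrite -ew.
have pe : perm_eq (rcons u m ++ a ++ b) (u ++ w).
  by rewrite ew -cats1; apply/permP => P; rewrite !count_cat /= ; lia.
have pl : perm_eq (labels (rcons u m ++ a ++ b)) (labels (u ++ w)) by exact: perm_map.
have := IH (rcons u m) (a ++ b).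
rewrite (perm_size pe) (perm_uniq pl) (weightE pe) => /(_ sn un) h.
have := h (fun x hx => wo x ltac:(by rewrite -(perm_mem pe))).
move=> hN; apply: (diff_null_sub (S := labels (rcons u m ++ a ++ b))).
  by move=> c; rewrite (perm_mem pl).
move: hN; congr diff_null; apply/funext => nu.
by rewrite /modes map_rcons map_cat.
Qed.

(** For a word of length 1 and weight at least [K] the letter is 0 by the
    assumption on L; with a smaller weight a difference is needed, and there is
    no nonzero one in a single variable. *)
Lemma pbw_level_null n : level_null n (pbw_level (@mode_br F L) on_vacuum n).
Proof.
elim: n => [|n IH] om sn un wo; first exact: diff_null0.
case: n IH sn => [|n] IH sn.
  case: om sn un wo => // x [|//] _ _ wo /= [|p d] /=.
    move=> _ hK nu; have [l hl] := wo x (mem_head _ _).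
    have -> : on_vacuum (mode_of nu x) = on_vacuum (0, nu x.1).
      congr on_vacuum; congr pair.
      apply: (GK (conformal_word_gt0 hl) hl); move: hK; rewrite /weight /=; lia.
    exact: (functional0 _ mode_functional_vacuum).
  rewrite !inE => /andP[/andP[/eqP e1 /eqP e2] hd] _ nu.
  rewrite -(@ldiffs0 F L d nu); apply: eq_ldiffs => {}nu.
  by rewrite /ldiff e1 e2 subrr.
have := null_sort_avg (@slotwise_pbw_vacuum _) IH n.+2 (u := [::]) sn un wo.
congr diff_null; apply/funext => nu.
by case: om sn {un wo} => [|x [|y om]].
Qed.

End Bounded.

(** * Vanishing between arbitrary words *)
Section Contexts.
Variables (F : fieldType) (pcharF : [pchar F] =i pred0).
Variables (L : lieConformalAlgType F) (G : set L) (K : int).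
Hypothesis Ggen : conformal_generates G.
Hypothesis GK : forall l : nat, (1 <= l)%N -> locality_le G l K.
Notation mode := (L * int)%type.
Notation letter := (nat * (L * nat))%type.
Implicit Types (om : seq letter) (u v c : seq mode).

Definition wordmodes u := forall x, x \in u -> is_word G x.1.

(** Variables labelled by [N] or more are given fixed indices. *)
Definition ext N (e nu : nat -> int) : nat -> int :=
  fun i => if (i < N)%N then nu i else e i.

(** A list of modes becomes a list of letters by inventing labels, the
    indices being recorded in [e]. *)
Lemma label_context c N : wordmodes c -> exists om e,
  [/\ uniq (labels om), all (leq N) (labels om), weighted_words G om, size om = size c &
      forall nu, (forall n, (N <= n)%N -> nu n = e n) -> modes nu om = c].
Proof.
elim: c N => [|x c IH] N hc; first by exists [::], (fun=> 0); split.
have [|om [e [h1 h2 h3 h4 h5]]] := IH N.+1.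
  by move=> y hy; apply: hc; rewrite inE hy orbT.
have [l [m hw]] := hc x (mem_head _ _).
exists ((N, (x.1, m)) :: om), (upd e N x.2); split=> /=.
- rewrite h1 andbT; apply/negP => /(allP h2); lia.
- rewrite leqnn /=; apply: sub_all h2 => y; lia.
- by move=> y; rewrite inE => /orP[/eqP ->|/h3 //]; exists l.
- by rewrite h4.
- move=> nu hnu; rewrite h5; first by rewrite /mode_of hnu // /upd eqxx; case: (x).
  by move=> n hn; rewrite hnu ?(ltnW hn) // /upd; case: eqP => // en; lia.
Qed.

Lemma lie_proj_null_words om d u v nu :
  uniq (labels om) -> weighted_words G om -> wordmodes u -> wordmodes v ->
  labels_in (labels om) d -> (K <= (size d)%:Z)%R ->
  ldiffs d (fun nu => @lie_proj F L (u ++ modes nu om ++ v)) nu = 0.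
Proof.
move=> un wo wu wv hd hK.
have [N ltN] := exists_fresh (labels om).
have [|omc [e [h1 h2 h3 h4 h5]]] := @label_context (u ++ v) N.
  by move=> x; rewrite mem_cat => /orP[/wu|/wv].
(* the modes of the context are letters too, in variables that are not varied *)
pose ou := take (size u) omc; pose ov := drop (size u) omc.
have pe : perm_eq (ou ++ om ++ ov) (om ++ omc).
  by rewrite perm_catCA perm_cat2l cat_take_drop.
have pl : perm_eq (labels (ou ++ om ++ ov)) (labels om ++ labels omc).
  by have := perm_map fst pe; rewrite [X in perm_eq _ X]map_cat.
have key nu' : lie_proj (u ++ modes nu' om ++ v) =
    lie_proj (modes (ext N e nu') (ou ++ om ++ ov)).
  congr lie_proj; rewrite /modes !map_cat -!/(modes _ _).
  have ec : modes (ext N e nu') omc = u ++ v.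
    by apply: h5 => n hn; rewrite /ext ltnNge hn.
  rewrite [modes _ ou]map_take [modes _ ov]map_drop -/(modes _ _) ec.
  rewrite take_size_cat // drop_size_cat //; congr (_ ++ (_ ++ _)).
  apply/eq_in_map => x hx; rewrite /mode_of /ext ltN //.
  exact: map_f.
rewrite (eq_ldiffs d key) (@ldiffs_comp _ _ d (fun nu =>
  lie_proj (modes nu (ou ++ om ++ ov))) (ext N e)).
  have := @pbw_level_null F pcharF L G K GK _ (ou ++ om ++ ov) erefl.
  rewrite (perm_uniq pl) cat_uniq un h1 andbT /= => hB.
  have e2 nu1 : lie_proj (modes nu1 (ou ++ om ++ ov)) =
      pbw_level (@mode_br F L) (@on_vacuum F L) (size (ou ++ om ++ ov)) (modes nu1
        (ou ++ om ++ ov)).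
    by rewrite /lie_proj /pbw_proj size_map.
  rewrite (eq_ldiffs d e2); apply: hB.
  - apply/hasPn => x /(allP h2) hx; apply/negP => /ltN; lia.
  - by move=> x; rewrite (perm_mem pe) mem_cat => /orP[/wo|/h3].
  - by apply: sub_all hd => p /andP[p1 p2]; rewrite !(perm_mem pl) !mem_cat p1 p2.
  - lia.
move=> p hp nu'; have /andP[p1 p2] := allP hd p hp.
by split; apply/funext => c; rewrite /ext /shiftv; case: ifP => // hc;
  case: eqP => [ec|]; rewrite ?addr0 //; move: hc; rewrite ec ltN.
Qed.

(** L is spanned by derivatives of words, so a condition on lists of modes
    which is linear in each letter only has to be checked when all letters are
    words. *)
Lemma all_modes (P : seq mode -> Prop) :
  (forall u v n, P (u ++ (0, n) :: v)) ->
  (forall u v k a b n, P (u ++ (a, n) :: v) -> P (u ++ (b, n) :: v) ->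
     P (u ++ (k *: a + b, n) :: v)) ->
  (forall u v a n, P (u ++ (a, n - 1) :: v) -> P (u ++ (cderiv a, n) :: v)) ->
  (forall u, wordmodes u -> P u) -> forall u, P u.
Proof.
move=> P0 PP PD Pw.
suff key u1 u2 : wordmodes u2 -> P (u1 ++ u2).
  by move=> u; rewrite -[u]cats0; apply: key.
elim/last_ind: u1 u2 => [|u1 [a n] IH] u2 h2; first exact: Pw.
rewrite cat_rcons; elim: (dspan_word Ggen a) n =>
  {a} [a wa||k a b _ ha _ hb|a _ ha] n //.
- by apply: IH => x; rewrite inE => /orP[/eqP ->|/h2].
- exact: PP.
- exact: PD.
Qed.

Definition gletters om := forall x, x \in om -> x.2.2 = 0%N /\ G x.2.1.

(** The functional vanishes on the ideal generated by the coefficients of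
    [P(z_1, ..., z_l) g_1(z_1) ... g_l(z_l)] with generators [g_i] and
    [deg P >= K]. *)
Definition generators_null (phi : seq mode -> L) := forall om d u v nu,
  uniq (labels om) -> gletters om -> labels_in (labels om) d ->
  (K <= (size d)%:Z)%R ->
  ldiffs d (fun nu => phi (u ++ modes nu om ++ v)) nu = 0.

Lemma lie_proj_null : generators_null (@lie_proj F L).
Proof.
move=> om d u v nu un go hd hK.
have wo : weighted_words G om.
  by move=> x /go [-> Gx]; exists 1%N; apply: conformal_word_gen.
have S := @lie_proj_slotwise F pcharF L.
suff key v0 : wordmodes v0 -> forall u0,
    ldiffs d (fun nu => @lie_proj F L (u0 ++ modes nu om ++ v0)) nu = 0.
  move: u; apply: (@all_modes (fun v1 => forall u,
    ldiffs d (fun nu => @lie_proj F L (u ++ modes nu om ++ v1)) nu = 0)).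
  - move=> v1 v2 n u; rewrite -[RHS](@ldiffs0 F L d nu); apply: eq_ldiffs => nu1.
    by have /= := functional0 n (S (u ++ modes nu1 om ++ v1) v2); rewrite -!catA.
  - move=> v1 v2 k a b n ha hb u.
    rewrite -[RHS](scaler0 _ k) -[RHS]addr0 -[X in _ = _ *: X + _](ha u) -[X in _ =
      _ + X](hb u) -ldiffsP.
    apply: eq_ldiffs => nu1.
    by have /= := (S (u ++ modes nu1 om ++ v1) v2).1 k a b n; rewrite -!catA.
  - move=> v1 v2 a n ha u.
    rewrite -[RHS](scaler0 _ (- n%:~R)) -[RHS]addr0 -[X in _ =
      _ *: X + _](ha u) -[X in _ = _ + X](@ldiffs0 F L d nu) -ldiffsP.
    apply: eq_ldiffs => nu1.
    have /= := (S (u ++ modes nu1 om ++ v1) v2).2 a n; rewrite -!catA => ->.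
    by rewrite addr0 scaleNr.
  - exact: key.
move=> wv; apply: (@all_modes (fun u0 =>
  ldiffs d (fun nu => @lie_proj F L (u0 ++ modes nu om ++ v0)) nu = 0)).
- move=> v1 v2 n; rewrite -[RHS](@ldiffs0 F L d nu); apply: eq_ldiffs => nu1.
  by have /= := functional0 n (S v1 (v2 ++ modes nu1 om ++ v0)); rewrite -catA.
- move=> v1 v2 k a b n ha hb.
  rewrite -[RHS](scaler0 _ k) -[RHS]addr0 -[X in _ = _ *: X + _]ha -[X in _ =
    _ + X]hb -ldiffsP.
  apply: eq_ldiffs => nu1.
  by have /= := (S v1 (v2 ++ modes nu1 om ++ v0)).1 k a b n; rewrite -!catA.
- move=> v1 v2 a n ha.
  rewrite -[RHS](scaler0 _ (- n%:~R)) -[RHS]addr0 -[X in _ =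
    _ *: X + _]ha -[X in _ = _ + X](@ldiffs0 F L d nu) -ldiffsP.
  apply: eq_ldiffs => nu1.
  have /= := (S v1 (v2 ++ modes nu1 om ++ v0)).2 a n; rewrite -!catA => ->.
  by rewrite addr0 scaleNr.
- by move=> u0 wu; apply: lie_proj_null_words.
Qed.

End Contexts.

(** * The space of test functionals *)
Section Endo.
Variables (F : fieldType) (V : lmodType F).

Lemma linear_submod : submod_prop (fun f : V -> V => linear f).
Proof.
split=> [k x y|k f g hf hg c x y].
  by rewrite -[LHS]/(0 : V) -[RHS]/(k *: (0 : V) + 0) scaler0 addr0.
by rewrite !fctE hf hg !scalerDr !scalerA mulrC addrACA.
Qed.

Definition endo := submod linear_submod.
HB.instance Definition _ := GRing.Lmodule.on endo.

Definition endo_fun (f : endo) : V -> V := val f.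

Lemma endo_linear (f : endo) : linear (endo_fun f).
Proof. exact: (@submodP _ _ _ linear_submod f). Qed.

Lemma comp_linear (f g : endo) : linear (endo_fun f \o endo_fun g).
Proof. by move=> k x y; rewrite /= !endo_linear. Qed.

(** A bare product instead of a ring structure, since the identity is 0 when
    the module is. *)
Definition endo_mul (f g : endo) : endo := submodS linear_submod (comp_linear f g).

Lemma endoP (f g : endo) : (forall x, endo_fun f x = endo_fun g x) -> f = g.
Proof. by move=> e; apply: val_inj; apply/funext. Qed.

Lemma endo_mul_linearl b : linear (endo_mul^~ b).
Proof. by move=> k x y; apply: endoP. Qed.

Lemma endo_mul_linearr a : linear (endo_mul a).
Proof. by move=> k x y; apply: endoP => v; rewrite /endo_fun /= endo_linear. Qed.

Lemma endo_mulA : associative endo_mul.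
Proof. by move=> x y z; apply: endoP. Qed.

End Endo.

Section Final.
Variables (F : fieldType) (pcharF : [pchar F] =i pred0).
Variables (L : lieConformalAlgType F) (G : set L) (K : int).
Hypothesis Ggen : conformal_generates G.
Hypothesis GK : forall l : nat, (1 <= l)%N -> locality_le G l K.
Notation mode := (L * int)%type.
Notation letter := (nat * (L * nat))%type.
Let nF := natF_neq0 pcharF.

(** Functionals on the quotient of the enveloping algebra of the modes by the
    ideal of the bound. *)
Definition test_functional (phi : seq mode ->
  L) := [/\ slotwise (@mode_functional F L L) phi,
  forall u x y v, phi (u ++ x :: y :: v) - phi (u ++ y :: x :: v) =
    brlin (@mode_br F L) (fun z => phi (u ++ z :: v)) x y & generators_null G K phi].

Lemma test_submod : submod_prop test_functional.
Proof.
split=> [|k f g [f1 f2 f3] [g1 g2 g3]].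
  split=> [u v|u x y v|om d u v nu _ _ _ _].
  - exact: mode_functional0.
  - by rewrite subrr brlin0.
  - exact: ldiffs0.
split=> [u v|u x y v|om d u v nu h1 h2 h3 h4].
- exact: mode_functionalP.
- rewrite !fctE /= opprD addrACA -scalerBr f2 g2 brlinD; congr (_ + _).
  by rewrite /brlin scaler_sumr; apply: eq_bigr => p _; rewrite !scalerA mulrC.
- by rewrite ldiffsP f3 // g3 // scaler0 addr0.
Qed.

Definition testmod := submod test_submod.
HB.instance Definition _ := GRing.Lmodule.on testmod.
Definition test_fun (phi : testmod) : seq mode -> L := val phi.

Lemma testmod_test phi : test_functional (test_fun phi).
Proof. exact: (@submodP _ _ _ test_submod phi). Qed.

Lemma testmodP phi psi : (forall w, test_fun phi w = test_fun psi w) -> phi = psi.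
Proof. by move=> e; apply: val_inj; apply/funext. Qed.

Lemma test_translate phi x : test_functional phi ->
  test_functional (fun w => phi (rcons w x)).
Proof.
move=> [f1 f2 f3]; split=> [u v|u y z v|om d u v nu h1 h2 h3 h4].
- have := f1 u (rcons v x); congr mode_functional; apply/funext => y.
  by rewrite rcons_cat.
- rewrite !rcons_cat /= f2; apply: eq_brlin => t; by rewrite rcons_cat.
- rewrite -[RHS](f3 om d u (rcons v x) nu h1 h2 h3 h4); apply: eq_ldiffs => nu1.
  by rewrite !rcons_cat.
Qed.

(** The dual of right multiplication: [x phi] takes [w] to [phi (w x)], so
    that operators compose in the order of their letters. *)
Definition translate (x : mode) (phi : testmod) : testmod :=
  submodS test_submod (test_translate x (testmod_test phi)).

Lemma translate_linear x : linear (translate x).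
Proof. by move=> k phi psi; apply: testmodP. Qed.

Notation R := (endo testmod).

Definition mode_field (a : L) : int -> R :=
  fun n => submodS (@linear_submod F testmod) (@translate_linear (a, n)).

Definition ev (x : R) (phi : testmod) (w : seq mode) : L := test_fun (endo_fun x phi) w.

Lemma evP x y : (forall phi w, ev x phi w = ev y phi w) -> x = y.
Proof. by move=> e; apply: endoP => phi; apply: testmodP => w; apply: e. Qed.

Lemma evB phi w x y : ev (x - y) phi w = ev x phi w - ev y phi w.
Proof. by []. Qed.

Lemma evM phi w x y : ev (endo_mul x y) phi w = ev x (endo_fun y phi) w.
Proof. by []. Qed.

Lemma ev_mode_field a n phi w : ev (mode_field a n) phi w =
  test_fun phi (rcons w (a, n)).
Proof. by []. Qed.

Lemma mode_field_linear : linear mode_field.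
Proof.
move=> k a b; apply/funext => n; apply: evP => phi w.
have [h _ _] := testmod_test phi.
have /= := (h w [::]).1 k a b n.
by rewrite !cats1.
Qed.

Lemma mode_field_deriv a : mode_field (cderiv a) = fderiv (mode_field a).
Proof.
apply/funext => n; apply: evP => phi w.
have [h _ _] := testmod_test phi.
have /= := (h w [::]).2 a n.
by rewrite !cats1.
Qed.

Notation mul := (@endo_mul F testmod).

(** The commutator relation satisfied by test functionals, read in terms of
    distributions. *)
Lemma mode_field_bracket n a b k : mode_field (a *[n] b) k = iter n (@zdiff F R)
  (fun i j => mul (mode_field a i) (mode_field b j) - mul (mode_field b j)
    (mode_field a i)) 0 k.
Proof.
apply: evP => phi w.
rewrite (@iter_zdiff_ev F R L (fun x => ev x phi w)) // ev_mode_field.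
have [h1 h2 _] := testmod_test phi.
have := brlin_coef pcharF a b n k (h1 w [::]); rewrite cats1 => <-.
apply: eq_iter_zdiff => i j; rewrite evB -h2.
by congr (_ - _); rewrite -cat_rcons cats1.
Qed.

(** The values of words under the field products, with their weights, before
    an algebra is available in which they are words. *)
Inductive field_word : nat -> (int -> R) -> Prop :=
| field_word_gen g : G g -> field_word 0 (mode_field g)
| field_word_mul m1 m2 n x y : field_word m1 x -> field_word m2 y ->
    field_word (m1 + m2 + n) (fldprod mul n x y).

Definition zero_off (S : seq nat) (T : seq nat) (nu : nat -> int) :=
  forall c, c \in S -> c \notin T -> nu c = 0.

(** [x] is the residue, in all variables but the one labelled [b], of the
    distributions of the letters [om] multiplied by the differences [d]. *)
Definition represents (x : int -> R) om d b :=
  [/\ uniq (labels om), gletters G om, labels_in (labels om) d, b \in labels om &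
   forall phi w nu, zero_off (labels om) [:: b] nu ->
     ev (x (nu b)) phi w = ldiffs d (fun nu => test_fun phi (w ++ modes nu om)) nu].

Lemma ldiffs_cat d1 d2 (h : (nat -> int) ->
  L) : ldiffs (d1 ++ d2) h = ldiffs d2 (ldiffs d1 h).
Proof. by elim: d1 h => //= p d1 IH h. Qed.

(** Multiplication by [(z_(b1) - z_(b2))^n] when the other indices are 0. *)
Lemma ldiffs_nseq n b1 b2 S (X : int -> int -> L) (T : (nat -> int) -> L) nu :
  b1 != b2 ->
  (forall nu, zero_off S [:: b1; b2] nu -> T nu = X (nu b1) (nu b2)) ->
  zero_off S [:: b1; b2] nu ->
  ldiffs (nseq n (b1, b2)) T nu = iter n (@zdiff F L) X (nu b1) (nu b2).
Proof.
move=> b12; elim: n X T => [|n IH] X T hT hz; first exact: hT.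
rewrite iterSr /=; apply: IH => // {hz}nu hz.
rewrite /ldiff !hT /=; first last.
- by move=> c cS cb; rewrite /shiftv hz //; move: cb;
  rewrite !inE negb_or => /andP[/negPf-> _].
- by move=> c cS cb; rewrite /shiftv hz //; move: cb;
  rewrite !inE negb_or => /andP[_ /negPf->].
by rewrite /zdiff /shiftv !eqxx (negPf b12) eq_sym (negPf b12) !addr0.
Qed.

(** Stated for all indices at [b1] and not only for the residue, since it is
    also the source of locality ([field_word_local]). *)
Lemma represents_pair x y om1 om2 d1 d2 b1 b2 n phi w nu :
  represents x om1 d1 b1 -> represents y om2 d2 b2 ->
  (forall c, c \in labels om1 -> c \in labels om2 -> False) ->
  zero_off (labels (om1 ++ om2)) [:: b1; b2] nu ->
  ev (iter n (@zdiff F R) (fpair mul x y) (nu b1) (nu b2)) phi w =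
  ldiffs ((d2 ++ d1) ++ nseq n (b1, b2))
    (fun nu => test_fun phi (w ++ modes nu (om1 ++ om2))) nu.
Proof.
move=> [u1 g1 l1 i1 e1] [u2 g2 l2 i2 e2] dis hz.
have b12 : b1 != b2 by apply/eqP => eb; apply: (dis b1); rewrite // eb.
rewrite (@iter_zdiff_ev F R L (fun x => ev x phi w)) //.
rewrite ldiffs_cat; symmetry; apply: (@ldiffs_nseq n b1 b2 (labels (om1 ++ om2))
  (fun i j => ev (fpair mul x y i j) phi w)
  _ nu b12 _ hz) => {hz}nu hz.
have lc : labels (om1 ++ om2) = labels om1 ++ labels om2 by exact: map_cat.
rewrite /fpair evM e1; last first.
  move=> c c1 cb; apply: hz; first by rewrite lc mem_cat c1.
  rewrite !inE negb_or; move: cb; rewrite inE => ->.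
  by apply/eqP => ec; apply: (dis c) => //; rewrite ec.
rewrite ldiffs_cat; symmetry; apply: ldiffs_local l1 _ => nu1 h1.
have n1 c : c \in labels om2 -> nu1 c = nu c.
  by move=> c2; apply: h1; apply/negP => c1; apply: (dis c).
rewrite -(n1 b2 i2) -[LHS]/(ev (y (nu1 b2)) phi (w ++ modes nu1 om1)) e2; last first.
  move=> c c2 cb; rewrite n1 //; apply: hz; first by rewrite lc mem_cat c2 orbT.
  rewrite !inE negb_or; move: cb; rewrite inE => ->; rewrite andbT.
  by apply/eqP => ec; apply: (dis c) => //; rewrite ec.
apply: ldiffs_local l2 _ => nu2 h2.
rewrite -catA /modes map_cat; congr (test_fun phi (w ++ (_ ++ _))).
apply/eq_in_map => z hz'; rewrite /mode_of h2 //.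
by apply/negP => z2; apply: (dis z.1) => //; apply: map_f.
Qed.

Lemma represents_pair_wf x y om1 om2 d1 d2 b1 b2 n :
  represents x om1 d1 b1 -> represents y om2 d2 b2 ->
  (forall c, c \in labels om1 -> c \in labels om2 -> False) ->
  [/\ uniq (labels (om1 ++ om2)), gletters G (om1 ++ om2) &
   labels_in (labels (om1 ++ om2)) ((d2 ++ d1) ++ nseq n (b1, b2))].
Proof.
move=> [u1 g1 l1 i1 _] [u2 g2 l2 i2 _] dis.
have lc : labels (om1 ++ om2) = labels om1 ++ labels om2 by exact: map_cat.
split.
- rewrite lc cat_uniq u1 u2 andbT /=; apply/hasPn => c c2.
  by apply/negP => c1; apply: (dis c).
- by move=> z; rewrite mem_cat => /orP[/g1|/g2].
- rewrite /labels_in !all_cat all_nseq /= lc !mem_cat i1 i2 !orbT.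
  apply/andP; split=> //; apply/andP; split.
    by apply: sub_all l2 => p /andP[p1 p2]; rewrite !mem_cat p1 p2 !orbT.
  by apply: sub_all l1 => p /andP[p1 p2]; rewrite !mem_cat p1 p2.
Qed.

(** The product with index [n] multiplies by [n] further differences of the
    two free variables, so the number of differences is the weight.  The
    labels of the second factor are chosen beyond those of the first. *)
Lemma field_word_represents m x N : field_word m x -> exists om d b,
  [/\ represents x om d b, all (leq N) (labels om) & size d = m].
Proof.
move=> hx; elim: hx N => {m x} [g Gg|m1 m2 n x y _ IH1 _ IH2] N.
  exists [:: (N, (g, 0%N))], [::], N; split=> //=; last by rewrite leqnn.
  split=> //=; [|by rewrite mem_head|].
    by move=> z; rewrite inE => /eqP ->.
  by move=> phi w nu _; rewrite ev_mode_field cats1.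
have [om1 [d1 [b1 [r1 a1 s1]]]] := IH1 N.
have [M ltM] := exists_fresh (labels om1).
have [om2 [d2 [b2 [r2 a2 s2]]]] := IH2 M.
have dis c : c \in labels om1 -> c \in labels om2 -> False.
  by move=> /ltM h1 /(allP a2) h2; lia.
have lc : labels (om1 ++ om2) = labels om1 ++ labels om2 by exact: map_cat.
have key := fun phi w nu => @represents_pair x y om1 om2 d1 d2 b1 b2 n phi w nu r1
  r2 dis.
have [_ _ _ i1 _] := r1; have [_ _ _ i2 _] := r2.
have [uc gc dc] := @represents_pair_wf x y om1 om2 d1 d2 b1 b2 n r1 r2 dis.
exists (om1 ++ om2), ((d2 ++ d1) ++ nseq n (b1, b2)), b2; split.
- split=> //.
  + by rewrite lc mem_cat i2 orbT.
  + move=> phi w nu hz; rewrite -key.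
      rewrite (_ : nu b1 = 0) //; apply: hz; first by rewrite lc mem_cat i1.
      by rewrite inE; apply/eqP => eb; apply: (dis b1); rewrite // eb.
    move=> c cS; rewrite !inE negb_or => /andP[_ cb]; apply: hz => //.
    by rewrite inE.
- rewrite lc all_cat a1 /=; apply: sub_all a2 => c hc.
  have := ltM b1 i1; have := allP a1 b1 i1; lia.
- by rewrite !size_cat size_nseq s1 s2; lia.
Qed.

Lemma field_word_eq0 m x : field_word m x -> (K <= m%:Z)%R -> x = 0.
Proof.
move=> hx hK; have [om [d [b [[h1 h2 h3 h4 h5] _ hs]]]] := field_word_represents 0 hx.
apply/funext => k; apply: evP => phi w.
have [_ _ hC] := testmod_test phi.
pose nu c := if c == b then k else 0.
have nb : nu b = k by rewrite /nu eqxx.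
have := h5 phi w nu; rewrite nb => ->; last first.
  by move=> c _; rewrite inE /nu => /negPf ->.
have := hC om d w [::] nu h1 h2 h3; rewrite hs => /(_ hK) e.
by rewrite -[RHS]e; apply: eq_ldiffs => nu1; rewrite cats0.
Qed.

Lemma field_word_local m1 m2 x y : field_word m1 x -> field_word m2 y -> flocal mul x y.
Proof.
move=> hx hy; have [om1 [d1 [b1 [r1 a1 s1]]]] := field_word_represents 0 hx.
have [M ltM] := exists_fresh (labels om1).
have [om2 [d2 [b2 [r2 a2 s2]]]] := field_word_represents M hy.
have dis c : c \in labels om1 -> c \in labels om2 -> False.
  by move=> /ltM h1 /(allP a2) h2; lia.
have [_ _ _ i1 _] := r1; have [_ _ _ i2 _] := r2.
have b12 : b1 != b2 by apply/eqP => eb; apply: (dis b1); rewrite // eb.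
(* K may be negative; any natural number not below it is a bound *)
exists `|K|%N => n i j hn; apply: evP => phi w.
have [uc gc dc] := @represents_pair_wf x y om1 om2 d1 d2 b1 b2 n r1 r2 dis.
pose nu c := if c == b1 then i else if c == b2 then j else 0.
have := @represents_pair x y om1 om2 d1 d2 b1 b2 n phi w nu r1 r2 dis.
have [nb1 nb2] : nu b1 = i /\ nu b2 = j.
  by rewrite /nu !eqxx eq_sym (negPf b12).
rewrite nb1 nb2 => ->; last first.
  by move=> c _; rewrite !inE negb_or /nu => /andP[/negPf -> /negPf ->].
have [_ _ hC] := testmod_test phi.
rewrite -[RHS](hC (om1 ++ om2) ((d2 ++ d1) ++ nseq n (b1, b2)) w [::] nu).
- by apply: eq_ldiffs => nu1; rewrite cats0.
- exact: uc.
- exact: gc.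
- exact: dc.
- rewrite !size_cat size_nseq; lia.
Qed.

Definition field_span : (int -> R) -> Prop :=
  dspan (@fderiv F R) (fun x => exists m, field_word m x).

Lemma field_span_submod : submod_prop field_span.
Proof. by split; [exact: dspan0 | move=> k x y; apply: dspan_lin]. Qed.

Lemma field_span_prod n x y : field_span x -> field_span y ->
  field_span (fldprod mul n x y).
Proof.
apply: dspan_pr.
- by move=> {}n b; apply: fldprod_linearl; apply: endo_mul_linearl.
- by move=> {}n a; apply: fldprod_linearr; apply: endo_mul_linearr.
- move=> {}n a b; apply: fderiv_prod;
  [exact: endo_mul_linearl | exact: endo_mul_linearr].
- move=> {}n a b; apply: fldprod_derivl; exact: endo_mul_linearl.
- move=> {}n {}x {}y [m1 w1] [m2 w2]; exists (m1 + m2 + n)%N.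
  exact: field_word_mul.
Qed.

Lemma field_span_local x y : field_span x -> field_span y -> flocal mul x y.
Proof.
have z1 c : flocal mul 0 c.
  exists 0%N => n i j _; rewrite -[RHS](@iter_zdiff0 F _ n i j).
  apply: eq_iter_zdiff => i1 j1; exact: endoP.
have z2 c : flocal mul c 0.
  exists 0%N => n i j _; rewrite -[RHS](@iter_zdiff0 F _ n i j).
  apply: eq_iter_zdiff => i1 j1; apply: endoP => v.
  exact: (linear_at0 (endo_linear (c i1))).
move=> hx hy; elim: hx => {x} [x [m1 w1]||k a b _ ha _ hb|a _ ha] //.
- elim: hy => {y} [y [m2 w2]||k a b _ ha _ hb|a _ ha] //.
  + exact: field_word_local w1 w2.
  + by apply: flocalPr => //; apply: endo_mul_linearr.
  + by apply: flocal_derivr => //; apply: endo_mul_linearr.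
- by apply: flocalPl => //; apply: endo_mul_linearl.
- by apply: flocal_derivl => //; apply: endo_mul_linearl.
Qed.

Lemma lie_proj_test : test_functional (@lie_proj F L).
Proof.
split; first exact: lie_proj_slotwise.
  exact: lie_proj_swap.
exact: (lie_proj_null pcharF).
Qed.

(** The mode [a(-1)] applied to the vacuum is [a]. *)
Lemma mode_field_inj : injective mode_field.
Proof.
move=> a b e; pose phi : testmod := submodS test_submod lie_proj_test.
have : ev (mode_field a (-1)) phi [::] = ev (mode_field b (-1)) phi [::] by rewrite e.
by rewrite !ev_mode_field /test_fun /= /lie_proj !pbw_proj1 /on_vacuum /=
  /cderiv_div /= fact0 invr1 !scale1r.
Qed.

End Final.

Theorem theorem1 (F : fieldType) (pcharF : [pchar F] =i pred0)
    (L : lieConformalAlgType F) (G : set L) (K : int) :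
  conformal_generates G ->
  (forall l : nat, (1 <= l)%N -> locality_le G l K) ->
  exists (A : assocConformalAlgType F) (phi : L -> cminus pcharF A),
    [/\ conformal_morphism phi,
        injective phi &
        forall l : nat, (1 <= l)%N -> @locality_le F A (phi @` G) l K].
Proof.
move=> Ggen GK; pose R := endo (testmod G K).
pose rho : L -> int -> R := @mode_field F L G K.
have rhoL : linear rho := @mode_field_linear F L G K.
have rhoD a : rho (cderiv a) = fderiv (rho a) by exact: mode_field_deriv.
have [A [io [ioL ioI [ioS Sio] ioD ioM]]] := field_algebra
  (@endo_mul_linearl F (testmod G K)) (@endo_mul_linearr F (testmod G K))
  (@endo_mulA F (testmod G K)) (@field_span_submod F L G K)
  (fun a => @dspan_D _ _ _ _ a) (@field_span_prod F L G K)
  (@field_span_local F L G K).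
have io_loc x y : flocal (@endo_mul F (testmod G K)) (io x) (io y).
  by apply: field_span_local.
have ioB n (x y : cminus pcharF A) a b : io x = rho a -> io y = rho b ->
    io (x *[n] y) = rho (a *[n] b).
  move=> ea eb; apply/funext => k.
  rewrite (iota_minus ioL ioD ioM io_loc) ea eb.
  exact/esym/(mode_field_bracket pcharF).
have rhoS a : @field_span F L G K (rho a).
  have : [set: L] a by [].
  rewrite -Ggen => /(_ [set a | @field_span F L G K (rho a)]).
  apply; split; last first.
    by move=> g Gg; apply: dspan_base; exists 0%N; apply: field_word_gen.
  split.
  - by rewrite /= (linear_at0 rhoL); apply: dspan0.
  - by move=> k x y hx hy /=; rewrite rhoL; apply: dspan_lin.
  - by move=> x hx /=; rewrite rhoD; apply: dspan_D.
  - move=> n x y /Sio [x' ex] /Sio [y' ey].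
    rewrite /= -(ioB n x' y' x y ex ey); exact: ioS.
pose phi a : cminus pcharF A := projT1 (cid (Sio _ (rhoS a))).
have phiE a : io (phi a) = rho a by rewrite /phi; case: cid.
exists A, phi; split.
- split.
  + by move=> k a b; apply: ioI; rewrite ioL !phiE rhoL.
  + by move=> a; apply: ioI; rewrite ioD !phiE rhoD.
  + by move=> n a b; apply: ioI; rewrite phiE; symmetry; apply: ioB.
- move=> a b e; have re : rho a = rho b by rewrite -!phiE e.
  exact: (mode_field_inj pcharF Ggen GK re).
move=> l l1 m x hw hK.
have hf : field_word m (io x).
  elim: hw {hK} => [g [a Ga <-]|l1' l2 m1 m2 n y z _ h1 _ h2].
    by rewrite phiE; apply: field_word_gen.
  by rewrite ioM; apply: field_word_mul.
by apply: ioI; rewrite (field_word_eq0 hf hK) (linear_at0 ioL).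
Qed.
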